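(* Let $\mathcal{E}$ be a metric space, let $\lambda,\kappa,\mu\colon\mathcal{E}\to[0,\infty)$ be continuous, and fix $t\ge 0$. Let $\{J_n\}_{n\in\mathbb{N}}$ be a sequence of $\mathcal{E}$-valued stochastic processes with càdlàg paths, and for each $n$ let $M_n(t)$ denote the number of jobs at time $t$ in the modulated infinite-server queue $(J_n,n\lambda,\kappa,\mu)$. Suppose that the laws $\nu_n$ of $\phi_t(J_n)$ on $\mathbb{R}$ satisfy a large deviations principle (LDP) with rate function $\psi$. Then $\frac{1}{n}M_n(t)$ satisfies an LDP with rate function $$I(a)=\inf_{\gamma\in\mathcal{R}(t)}\big[\ell(\gamma;a)+\psi(\gamma)\big],\qquad a\in\mathbb{R},$$ that is, $\limsup_{n\to\infty}\frac1n\log\mathbb{P}(\frac1n M_n(t)\in F)\le-\inf_{a\in F}I(a)$ for every closed $F\subset\mathbb{R}$ and $\liminf_{n\to\infty}\frac1n\log\mathbb{P}(\frac1n M_n(t)\in G)\ge-\inf_{a\in G}I(a)$ for every open $G\subset\mathbb{R}$.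
   Context: For a càdlàg $f\colon[0,\infty)\to\mathcal{E}$ and $t\ge0$, $\phi_t(f)=\int_0^t\lambda(f(s))\exp\!\big(-\kappa(f(s))\int_s^t\mu(f(r))\,dr\big)\,ds$. The modulated infinite-server queue $(J,\lambda,\kappa,\mu)$: $J$ is an $\mathcal{E}$-valued càdlàg background process; the system starts empty; jobs arrive at the jump times $\tau_1,\tau_2,\dots$ of $Y(t)=\bar Y(\int_0^t\lambda(J(s))\,ds)$, where $\bar Y$ is a standard Poisson process independent of $J$; job $k$ gets service requirement $\bar Z_k/\kappa(J(\tau_k))$ (equal to $\infty$ if $\kappa(J(\tau_k))=0$), where $\bar Z_1,\bar Z_2,\dots$ are i.i.d. standard exponential, independent of everything else; each job has its own server, which processes work at rate $\mu(J(s))$ at time $s$; a job leaves once its requirement has been processed. The queue $(J_n,n\lambda,\kappa,\mu)$ is the same with arrival rate function $n\lambda$ and background process $J_n$. A sequence of probability measures $\tau_n$ on a topological space satisfies an LDP with rate function $\rho$ if $\rho\colon\to[0,\infty]$ is lower semicontinuous (not necessarily with compact level sets), $\limsup\frac1n\log\tau_n(F)\le-\inf_F\rho$ for closed $F$ and $\liminf\frac1n\log\tau_n(G)\ge-\inf_G\rho$ for open $G$. A number $\gamma\in[0,\infty)$ is an attainable parameter at time $t$ if for every $\epsilon>0$ there is $N_\epsilon$ with $\mathbb{P}(\phi_t(J_n)\in(\gamma-\epsilon,\gamma+\epsilon))>0$ for all $n\ge N_\epsilon$; $\mathcal{R}(t)$ is the set of attainable parameters at time $t$. For $\gamma\ge0$,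 $\ell(\gamma;a)=\infty$ if $a<0$, $\ell(\gamma;0)=\gamma$, and $\ell(\gamma;a)=\gamma-a+a\log(a/\gamma)$ for $a>0$ (interpreted as $\infty$ when $\gamma=0$, $a>0$); this is the Fenchel–Legendre transform of the cumulant generating function of a Poisson($\gamma$) variable. *)

(* Defs.v *)
From HB Require Import structures.
From mathcomp Require Import all_boot all_order all_algebra.
From mathcomp Require Import all_classical all_reals all_analysis.
Set Implicit Arguments. Unset Strict Implicit. Unset Printing Implicit Defensive.
Import Order.TTheory GRing.Theory Num.Theory.
Import numFieldNormedType.Exports.
Local Open Scope classical_set_scope.
Local Open Scope ring_scope.

Section Defs.
Variable R : realType.

Definition Rint (a b : R) (g : R -> R) : R :=
  Rintegral (@lebesgue_measure R) `[a, b] g.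

Definition phi {E : Type} (lam kap mu : E -> R) (t : R) (f : R -> E) : R :=
  Rint 0 t (fun s => lam (f s) *
                     expR (- kap (f s) * Rint s t (fun r => mu (f r)))).

Definition cadlag {E : topologicalType} (f : R -> E) : Prop :=
  (forall s, 0 <= s -> f x @[x --> s^'+] --> f s) /\
  (forall s, 0 < s -> exists l : E, f x @[x --> s^'-] --> l).

(** Number of jobs at time t in the modulated infinite-server queue
    (J, lam, kap, mu), for given sample paths:
    J the background path, Ybar the standard Poisson path, Z the standard
    exponential marks (job k, k = 0,1,2,..., i.e. the (k+1)-th arrival,
    uses Z k). *)
Definition arrival_count {E : Type} (lam : E -> R) (J : R -> E)
  (Ybar : R -> nat) (u : R) : nat :=
  Ybar (Rint 0 u (fun s => lam (J s))).

(** time of the (k+1)-th arrival (jump of Y, counted with multiplicity) *)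
Definition arrival_time {E : Type} (lam : E -> R) (J : R -> E)
  (Ybar : R -> nat) (k : nat) : R :=
  inf [set u | 0 <= u /\ (k < arrival_count lam J Ybar u)%N].

(** job k (arrived by time t) is still present at time t: its processed
    work int_{tau_k}^t mu(J r) dr is strictly less than its requirement
    Z k / kap (J tau_k), which is infinite when kap (J tau_k) = 0. *)
Definition job_present {E : Type} (lam kap mu : E -> R) (J : R -> E)
  (Ybar : R -> nat) (Z : nat -> R) (t : R) (k : nat) : bool :=
  let tk := arrival_time lam J Ybar k in
  let c := kap (J tk) in
  (c == 0) || (Rint tk t (fun r => mu (J r)) < Z k / c).

Definition queue_count {E : Type} (lam kap mu : E -> R) (J : R -> E)
  (Ybar : R -> nat) (Z : nat -> R) (t : R) : nat :=
  (\sum_(k < arrival_count lam J Ybar t) job_present lam kap mu J Ybar Z t k)%N.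

Local Open Scope ereal_scope.

Definition elog (x : \bar R) : \bar R :=
  match x with
  | r%:E => if r == 0%R then -oo else (ln r)%:E
  | +oo => +oo
  | -oo => -oo
  end.

Definition LDP (nu : nat -> set R -> \bar R) (rho : R -> \bar R) : Prop :=
  (forall x, 0 <= rho x) /\ lower_semicontinuous rho /\
  (forall F : set R, closed F ->
     limn_esup (fun n => (n%:R^-1)%:E * elog (nu n F)) <= - ereal_inf (rho @` F)) /\
  (forall G : set R, open G ->
     - ereal_inf (rho @` G) <= limn_einf (fun n => (n%:R^-1)%:E * elog (nu n G))).

(** Fenchel-Legendre transform of the Poisson(gamma) cgf *)
Definition ell (gamma a : R) : \bar R :=
  if (a < 0)%R then +oo
  else if a == 0%R then gamma%:E
  else if gamma == 0%R then +oo
  else (gamma - a + a * ln (a / gamma))%:E.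

End Defs.

Section Prob.
Local Open Scope ereal_scope.
Context {d : measure_display} {Omega : measurableType d} {R : realType}.

Definition mutually_independent (P : probability Omega R) (I : eqType)
  (G : I -> set (set Omega)) : Prop :=
  forall (s : seq I) (A : I -> set Omega), uniq s ->
    (forall i, i \in s -> G i (A i)) ->
    P (\big[setI/setT]_(i <- s) A i) = \prod_(i <- s) P (A i).

Definition sigma_process {E : topologicalType} (X : Omega -> R -> E)
  : set (set Omega) :=
  <<s [set A | exists s B, (0 <= s)%R /\ open B /\ A = (fun w => X w s) @^-1` B] >>.

Definition sigma_nat_process (Y : Omega -> R -> nat) : set (set Omega) :=
  <<s [set A | exists s k, (0 <= s)%R /\ A = [set w | Y w s = k]] >>.

Definition sigma_rv (X : Omega -> R) : set (set Omega) :=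
  <<s [set A | exists B, measurable B /\ A = X @^-1` B] >>.

Definition poisson_pmf (r : R) (k : nat) : R :=
  (expR (- r) * r ^+ k / (k`!)%:R)%R.

Definition std_poisson_process (P : probability Omega R) (Y : Omega -> R -> nat)
  : Prop :=
  (forall w, Y w 0%R = 0%N) /\
  (forall w s u, (0 <= s)%R -> (s <= u)%R -> (Y w s <= Y w u)%N) /\
  (forall w s, (0 <= s)%R -> Y w x @[x --> s^'+] --> Y w s) /\
  (forall s k, measurable [set w | Y w s = k]) /\
  (forall (m : nat) (s : nat -> R) (k : nat -> nat),
     s 0%N = 0%R -> (forall i, (s i <= s i.+1)%R) ->
     P (\big[setI/setT]_(i < m) [set w | (Y w (s i.+1) - Y w (s i))%N = k i])
     = (\prod_(i < m) poisson_pmf (s i.+1 - s i) (k i))%:E).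

Definition std_exponential (P : probability Omega R) (X : Omega -> R) : Prop :=
  measurable_fun setT X /\
  forall x : R, P [set w | (X w <= x)%R] =
    (if (0 <= x)%R then 1 - expR (- x) else 0)%:E.

End Prob.

(* Main.v *)
Require Import Defs.
From HB Require Import structures.
From mathcomp Require Import all_boot all_order all_algebra.
From mathcomp Require Import all_classical all_reals all_analysis.
From mathcomp Require Import measurable_realfun ring lra.
Import Order.TTheory GRing.Theory Num.Theory.
Import numFieldNormedType.Exports.
Local Open Scope classical_set_scope.
Local Open Scope ring_scope.

(** Given the background path [J], the arrivals form a Poisson process with
    cumulative rate [\int lam(J)], and the job arriving at [s] is still present at
    [t] with probability [exp(- kap(J s) \int_s^t mu(J))], independently of the
    others; by thinning, the number of jobs at [t] is Poisson with mean
    [phi_t(J)].  The conditional generating function is obtained by integrating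
    out the exponential marks exactly, approximating the resulting product over
    the arrival times by a product over the cells of a grid, and using the
    independent Poisson increments.  Hence [M_n] is a Poisson variable with random
    parameter [n phi_t(J_n)].

    For the upper bound on a closed [F], let [h(g)] be the infimum of [ell g a]
    over [a] in [F].  Chernoff's bound gives
    [P(M_n / n \in F | phi_t(J_n) = g) <= 2 exp(- n h(g))], and, the sublevel sets
    of [h] being closed, slicing the values of [h] yields the rate
    [inf (h + psi)], without any compactness of the level sets of [psi].  The lower
    bound localises [phi_t(J_n)] near [g] and uses the explicit Poisson weights and
    an elementary form of Stirling's bound. *)

(** * Independence and Fubini *)

(** [E] is an arbitrary metric space, so no regular conditional law of the background path is at
    hand. Conditioning is replaced by viewing [Omega] through three smaller sigma-algebras,
    generated by background, arrivals and marks: the identity maps into them are independent, and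
    iterated integrals take the place of conditional expectations. The price is joint measurability
    of the queue count in three separate sample points; it comes from grid approximations from the
    right. Two features of the statement shape the second half. And since neither [F] nor the level
    sets of [psi] are compact, coercivity has to come from [ell] alone, written as a supremum of
    functions linear in both arguments: the slope [1] controls large [a], the slope [- 1] controls
    large [g]. *)

Section decoupling.
Local Open Scope ereal_scope.
Context {d : measure_display} {Omega : measurableType d} {R : realType}.
Variable P : probability Omega R.

(** The finite measures sending [A] to the probability of its intersection with [B], and to
    [P A * P B], agree on the intersection-stable class [G]; uniqueness of measures extends this to
    [<<s G >>]. The set [setT] is adjoined to [G] to meet the covering condition of the uniqueness
    theorem. *)
Lemma independent_generated1 (G : set (set Omega)) (B : set Omega) :
  G `<=` measurable -> setI_closed G -> measurable B ->
  (forall A, G A -> P (A `&` B) = P A * P B) ->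
  forall A, <<s G >> A -> P (A `&` B) = P A * P B.
Proof.
move=> Gm GI mB GB A sA.
pose G' := G `|` [set setT].
have G'm : G' `<=` measurable by move=> X [/Gm|->].
have PB_ge0 : (0 <= fine (P B))%R by rewrite fine_ge0.
pose m1 : {measure set Omega -> \bar R} := mrestr P mB.
pose m2 : {measure set Omega -> \bar R} := mscale (NngNum PB_ge0) P.
have PBE : (fine (P B))%:E = P B by rewrite fineK// fin_num_measure.
have : m1 A = m2 A.
  apply: (g_sigma_algebra_measure_unique G' G'm (fun=> setT)).
  - by move=> _; right.
  - by rewrite bigcup_const.
  - move=> X Y [GX|->] [GY|->]; rewrite ?setTI ?setIT; [left|left|left|right] => //.
    exact: GI.
  - move=> X [GX|->]; rewrite /m1/= /mrestr /mscale/= PBE muleC.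
      by rewrite GB// muleC.
    by rewrite setTI probability_setT mul1e.
  - by move=> _; rewrite /m1/= /mrestr/= setTI; rewrite -ge0_fin_numE ?fin_num_measure.
  - by apply: (sub_smallest2r _ _ sA) => [|X GX]; [exact: smallest_sigma_algebra|left].
by rewrite /m1/= /mrestr /mscale/= PBE muleC => ->; rewrite muleC.
Qed.

Lemma independent_generated2 (G1 G2 : set (set Omega)) :
  G1 `<=` measurable -> setI_closed G1 ->
  G2 `<=` measurable -> setI_closed G2 ->
  (forall A B, G1 A -> G2 B -> P (A `&` B) = P A * P B) ->
  forall A B, <<s G1 >> A -> <<s G2 >> B -> P (A `&` B) = P A * P B.
Proof.
move=> G1m G1I G2m G2I G12 A B sA sB.
have s1m := smallest_sub (@sigma_algebra_measurable _ Omega) G1m.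
apply: (independent_generated1 G1) sA => //.
  exact: (smallest_sub (@sigma_algebra_measurable _ Omega) G2m).
move=> {}A GA; rewrite setIC muleC.
apply: (independent_generated1 G2) sB => //; first exact: G1m.
by move=> {}B GB; rewrite setIC muleC G12.
Qed.


Lemma measurable_id_g_sigma_algebra (G : set (set Omega)) :
  G `<=` measurable ->
  measurable_fun setT ((fun w => w) : Omega -> g_sigma_algebraType G).
Proof.
move=> Gm _ A mA; rewrite setTI.
exact: (smallest_sub (@sigma_algebra_measurable _ Omega) Gm).
Qed.

Definition independent_rv {d1 d2 : measure_display} {T1 : measurableType d1}
  {T2 : measurableType d2} (X1 : Omega -> T1) (X2 : Omega -> T2) : Prop :=
  forall A B, measurable A -> measurable B ->
    P (X1 @^-1` A `&` X2 @^-1` B) = P (X1 @^-1` A) * P (X2 @^-1` B).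

(** Independence makes the joint law a product, so Tonelli applies, and the two marginals are pulled
    back to [P]. This is the substitute for conditioning on [X1]. *)
Lemma decouple (d1 d2 : measure_display) (T1 : measurableType d1)
    (T2 : measurableType d2) (X1 : Omega -> T1) (X2 : Omega -> T2)
    (f : T1 * T2 -> \bar R) :
  measurable_fun setT X1 -> measurable_fun setT X2 -> independent_rv X1 X2 ->
  measurable_fun setT f -> (forall x, 0 <= f x) ->
  \int[P]_w f (X1 w, X2 w) = \int[P]_w1 \int[P]_w2 f (X1 w1, X2 w2).
Proof.
move=> mX1 mX2 X12 mf f0.
pose D : Omega -> T1 * T2 := fun w => (X1 w, X2 w).
have mD : measurable_fun setT D by exact: measurable_fun_pair.
pose f1 : {mfun Omega >-> T1} := HB.pack X1 (isMeasurableFun.Build _ _ _ _ _ mX1).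
pose f2 : {mfun Omega >-> T2} := HB.pack X2 (isMeasurableFun.Build _ _ _ _ _ mX2).
pose fD : {mfun Omega >-> (T1 * T2)%type} :=
  HB.pack D (isMeasurableFun.Build _ _ _ _ _ mD).
pose P1 : probability T1 R := distribution P f1.
pose P2 : probability T2 R := distribution P f2.
pose PD : probability _ R := distribution P fD.
transitivity (\int[PD]_z f z).
  by rewrite ge0_integral_pushforward.
transitivity (\int[P1 \x P2]_z f z).
  apply/esym/eq_measure_integral => X mX _.
  apply: product_measure_unique => // A B; exact: X12.
rewrite fubini_tonelli1// ge0_integral_pushforward//; last 2 first.
  exact: measurable_fun_fubini_tonelli_F.
  by move=> w _; exact: integral_ge0.
apply: eq_integral => w _ /=.
rewrite /fubini_F ge0_integral_pushforward//.
by apply: measurableT_comp => //; exact: measurable_pair1.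
Qed.

Lemma g_sigma_algebra_preimage_image (T T' : Type) (f : T -> T')
    (G : set (set T')) (A : set T') :
  <<s G >> A -> <<s [set f @^-1` C | C in G] >> (f @^-1` A).
Proof.
set S := <<s [set _ | _ in G] >>.
have [S0 SC SU] : sigma_algebra setT S by exact: smallest_sigma_algebra.
move: A; apply: (@smallest_sub _ _ G [set A | S (f @^-1` A)]).
  split => /=; first by rewrite preimage_set0.
  - by move=> A /SC; rewrite !setTD preimage_setC.
  - by move=> F SF; rewrite preimage_bigcup; exact: SU.
by move=> C GC; apply: sub_sigma_algebra; exists C.
Qed.

(** Rectangles form an intersection-stable generator of the product, so the factorisation is only
    checked on rectangles against [G]. The case [C = setT] supplies the independence of [X1] and
    [X2]. *)
Lemma independent_rv_pair (d1 d2 d3 : measure_display) (T1 : measurableType d1)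
    (T2 : measurableType d2) (T3 : measurableType d3)
    (X1 : Omega -> T1) (X2 : Omega -> T2) (X3 : Omega -> T3) (G : set (set T3)) :
  measurable_fun setT X1 -> measurable_fun setT X2 -> measurable_fun setT X3 ->
  setI_closed G -> G setT -> @measurable _ T3 = <<s G >> ->
  (forall A B C, measurable A -> measurable B -> G C ->
    P (X1 @^-1` A `&` (X2 @^-1` B `&` X3 @^-1` C)) =
    P (X1 @^-1` A) * (P (X2 @^-1` B) * P (X3 @^-1` C))) ->
  independent_rv (fun w => (X1 w, X2 w)) X3.
Proof.
move=> mX1 mX2 mX3 GI GT GE indep.
have tT : G `<=` @measurable _ T3 by rewrite GE => C GC; exact: sub_sigma_algebra.
have mpre dd (T : measurableType dd) (X : Omega -> T) A :
    measurable_fun setT X -> measurable A -> measurable (X @^-1` A).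
  by move=> mX mA; rewrite -[X in measurable X]setTI; exact: mX.
pose H := [set A `*` B | A in @measurable _ T1 & B in @measurable _ T2].
pose H1 := [set (fun w => (X1 w, X2 w)) @^-1` A | A in H].
pose H2 := [set X3 @^-1` C | C in G].
have key : forall A B, <<s H1 >> A -> <<s H2 >> B -> P (A `&` B) = P A * P B.
  apply: independent_generated2.
  - move=> _ [_ [A mA [B mB <-]] <-].
    exact: measurableI (mpre _ _ X1 A mX1 mA) (mpre _ _ X2 B mX2 mB).
  - move=> _ _ [_ [A mA [B mB <-]] <-] [_ [A' mA' [B' mB' <-]] <-].
    rewrite -preimage_setI -setXI; eexists; last reflexivity.
    by exists (A `&` A'); [exact: measurableI|exists (B `&` B') => //; exact: measurableI].
  - by move=> _ [C GC <-]; apply: mpre => //; exact: tT.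
  - move=> _ _ [C GC <-] [C' GC' <-]; rewrite -preimage_setI.
    by exists (C `&` C') => //; exact: GI.
  - move=> _ _ [_ [A mA [B mB <-]] <-] [C GC <-].
    have := indep A B setT mA mB GT.
    rewrite preimage_setT setIT probability_setT mule1 => XAB.
    rewrite [(fun w => _) @^-1` _](_ : _ = X1 @^-1` A `&` X2 @^-1` B)//.
    by rewrite -setIA indep// XAB muleA.
move=> A C mA mC; apply: key.
  rewrite /H1; apply: g_sigma_algebra_preimage_image.
  by move: mA; rewrite measurable_prod_measurableType.
by rewrite /H2; apply: g_sigma_algebra_preimage_image; rewrite -GE.
Qed.
End decoupling.

(** * Products of independent discrete variables *)

Section discrete_products.
Local Open Scope ereal_scope.
Context {d : measure_display} {Omega : measurableType d} {R : realType}.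

Lemma nneseries_single (f : nat -> \bar R) (k0 : nat) :
  0 <= f k0 -> (forall k, k != k0 -> f k = 0) -> \sum_(k <oo) f k = f k0.
Proof.
move=> f0 fk; rewrite (@nneseriesD1 _ _ k0)//; last first.
  by move=> k _; have [->//|/fk->] := eqVneq k k0.
by rewrite eseries0 ?adde0// => i _ /andP[_ ik]; exact: fk.
Qed.

Lemma measurable_fun_nat_valued (N : Omega -> nat) :
  (forall k, measurable [set w | N w = k]) -> measurable_fun setT N.
Proof.
move=> mN _ Y _; rewrite setTI.
rewrite [_ @^-1` _](_ : _ = \bigcup_(k in Y) [set w | N w = k]).
  by apply: bigcup_measurable => k _; exact: mN.
by apply/seteqP; split => [w Yw|w [k Yk /= ->]//]; exists (N w).
Qed.

Lemma measurable_nat_preimage (N : Omega -> nat) (Y : set nat) :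
  measurable_fun setT N -> measurable (N @^-1` Y).
Proof. by move=> mN; rewrite -[X in measurable X]setTI; exact: mN. Qed.

(** Only the joint mass function is assumed to factor. Indicators of single values are exchanged for
    the functions [f i] one index at a time, each exchange being a sum over the values of one
    variable. *)
Lemma integral_prod_independent (P : probability Omega R) (m : nat)
    (N : Omega -> nat -> nat) (p f : nat -> nat -> R)
    (S : nat -> R) :
  (forall i, measurable_fun setT (N ^~ i)) ->
  (forall i k, 0 <= p i k)%R -> (forall i k, 0 <= f i k)%R ->
  (forall k : nat -> nat, P (\big[setI/setT]_(i < m) [set w | N w i = k i]) =
    (\prod_(i < m) p i (k i))%:E) ->
  (forall i, \sum_(k <oo) (f i k * p i k)%:E = (S i)%:E) ->
  \int[P]_w (\prod_(i < m) f i (N w i))%:E = (\prod_(i < m) S i)%:E.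
Proof.
move=> mN p0 f0 Pk fpS.
(* The interpolating product: factors below [j] already carry [f], the others are still indicators
   of prescribed values. *)
pose g j (k : nat -> nat) i l : R :=
  if (i < j)%N then f i l else (l == k i)%:R%R.
have g0 j k i l : (0 <= g j k i l)%R by rewrite /g; case: ifP.
have mg j k : measurable_fun setT (fun w => \prod_(i < m) g j k i (N w i))%R.
  apply: measurable_prod => i _.
  by apply: (@measurableT_comp _ _ _ _ _ _ (g j k i)) => //; exact: mN.
have claim j : (j <= m)%N -> forall k,
    \int[P]_w (\prod_(i < m) g j k i (N w i))%:E =
    (\prod_(i < m) (if (i < j)%N then S i else p i (k i)))%:E.
  elim: j => [_ k|j IH jm k].
    rewrite [RHS](_ : _ = (\prod_(i < m) p i (k i))%:E)//.
    rewrite -Pk.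
    have mB : measurable (\big[setI/setT]_(i < m) [set w | N w i = k i]).
      apply: bigsetI_measurable => i _.
      exact: (measurable_nat_preimage (N ^~ i) [set k i]).
    rewrite -[in RHS](setIT (\big[_/_]_(i < m) _)) -integral_indic//.
    apply: eq_integral => w _; congr EFin.
    rewrite indicE; case: (boolP (w \in _)) => [|/negP wN].
      rewrite inE -(bigcap_mkord m (fun i => [set w | N w i = k i])) => Nk; rewrite big1// => i _.
      by have /= Nki := Nk i (ltn_ord i); rewrite /g ltn0 Nki eqxx.
    have [i Ni] : exists i : 'I_m, N w i != k i.
      apply: contrapT => NN; apply: wN; rewrite inE
        -(bigcap_mkord m (fun i => [set w | N w i = k i])) => i/= im.
      by apply: contrapT => /eqP Nki; apply: NN; exists (Ordinal im).
    by rewrite (bigD1 i)//= /g (negbTE Ni) mul0r.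
  transitivity (\sum_(l <oo) \int[P]_w ((f j l)%:E *
      (\prod_(i < m) g j (fun i => if i == j then l else k i) i (N w i))%:E)).
    rewrite -integral_nneseries//; last 2 first.
    - by move=> l; apply: measurable_funeM; apply/measurable_EFinP; exact: mg.
    - by move=> l w _; rewrite -EFinM lee_fin mulr_ge0// prodr_ge0.
    apply: eq_integral => w _.
    rewrite (@nneseries_single _ (N w j)).
    - rewrite -EFinM; congr EFin.
      rewrite (bigD1 (Ordinal jm))//= [in RHS](bigD1 (Ordinal jm))//=.
      rewrite {1 3}/g ltnSn ltnn !eqxx mul1r; congr (_ * _)%R.
      apply: eq_bigr => i; rewrite -val_eqE/= => ij.
      by rewrite /g ltnS leq_eqVlt (negbTE ij).
    - by rewrite -EFinM lee_fin mulr_ge0// prodr_ge0.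
    - move=> l lN; rewrite (bigD1 (Ordinal jm))//= {1}/g ltnn eqxx.
      by rewrite eq_sym (negbTE lN) mul0r mule0.
  transitivity (\sum_(l <oo) ((\prod_(i < m | i != Ordinal jm)
      (if (i < j.+1)%N then S i else p i (k i)))%:E * (f j l * p j l)%:E)).
    apply: eq_eseriesr => l _; rewrite ge0_integralZl//; last 3 first.
    - by apply/measurable_EFinP; exact: mg.
    - by move=> w _; rewrite lee_fin prodr_ge0.
    - by rewrite lee_fin.
    rewrite IH ?(ltnW jm)// (bigD1 (Ordinal jm))//= ltnn eqxx.
    rewrite -!EFinM mulrA mulrC; congr (_ * _)%:E.
    apply: eq_bigr => i; rewrite -val_eqE/= => ij.
    by rewrite [in RHS]ltnS [in RHS]leq_eqVlt (negbTE ij).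
  rewrite nneseriesZl; last by move=> l _; rewrite lee_fin mulr_ge0.
  by rewrite fpS -EFinM mulrC [in RHS](bigD1 (Ordinal jm))//= ltnSn.
have := claim m (leqnn m) (fun=> 0%N).
rewrite [X in _ = X%:E](_ : _ = \prod_(i < m) S i)%R; last first.
  by apply: eq_bigr => i _; rewrite ltn_ord.
move=> <-; apply: eq_integral => w _; congr EFin.
by apply: eq_bigr => i _; rewrite /g ltn_ord.
Qed.
End discrete_products.

Section poisson_generating_function.
Context {R : realType}.

Lemma eseries_EFin_cvg (f : nat -> R) (l : R) :
  (forall k, 0 <= f k) -> series f @ \oo --> l ->
  (\sum_(k <oo) (f k)%:E = l%:E)%E.
Proof.
move=> f0 fl; apply/cvg_lim => //.
under eq_fun do rewrite sumEFin.
by apply: cvg_EFin => //; exact: nearW.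
Qed.

Lemma poisson_pmf_sum_pow (r z : R) : 0 <= r -> 0 <= z ->
  (\sum_(k <oo) (z ^+ k * Defs.poisson_pmf r k)%:E = (expR (r * (z - 1)))%:E)%E.
Proof.
move=> r0 z0; apply: eseries_EFin_cvg.
  by move=> k; rewrite /Defs.poisson_pmf !mulr_ge0 ?expR_ge0 ?exprn_ge0 ?invr_ge0.
rewrite (_ : (fun k => _) = (fun k => expR (- r) * exp_coeff (r * z) k)); last first.
  apply/funext => k; rewrite /Defs.poisson_pmf /exp_coeff/= exprMn; ring.
rewrite (_ : r * (z - 1) = - r + r * z); last by ring.
rewrite expRD.
rewrite (_ : series _ = (fun n => expR (- r) * series (exp_coeff (r * z)) n)); last first.
  by apply/funext => n; rewrite /series/= mulr_sumr.
by apply: cvgMr; exact: is_cvg_series_exp_coeff.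
Qed.
End poisson_generating_function.

Section thinning.
Local Open Scope ereal_scope.
Context {d : measure_display} {Omega : measurableType d} {R : realType}.
Variable P : probability Omega R.

Lemma poisson_pmf_ge0 (r : R) k : (0 <= r)%R -> (0 <= Defs.poisson_pmf r k)%R.
Proof. by move=> r0; rewrite /Defs.poisson_pmf !mulr_ge0 ?expR_ge0 ?exprn_ge0 ?invr_ge0. Qed.

Lemma poisson_increments_pow (Y : Omega -> R -> nat) (s q : nat -> R) (m : nat) :
  std_poisson_process P Y ->
  s 0%N = 0%R -> (forall i, (s i <= s i.+1)%R) -> (forall i, (0 <= q i)%R) ->
  \int[P]_w (\prod_(i < m) q i ^+ (Y w (s i.+1) - Y w (s i))%N)%:E =
  (\prod_(i < m) expR ((s i.+1 - s i) * (q i - 1)))%:E.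
Proof.
move=> [_ [_ [_ [mY incr]]]] s0 s_le q0.
apply: (@integral_prod_independent _ _ _ P m
  (fun w i => (Y w (s i.+1) - Y w (s i))%N)
  (fun i k => Defs.poisson_pmf (s i.+1 - s i) k) (fun i k => q i ^+ k)%R
  (fun i => expR ((s i.+1 - s i) * (q i - 1)))%R) => [i|i k|i k|k|i].
- apply: measurable_fun_subn; apply: measurable_fun_nat_valued; exact: mY.
- by rewrite poisson_pmf_ge0// subr_ge0.
- by rewrite exprn_ge0.
- exact: incr.
- by rewrite poisson_pmf_sum_pow ?subr_ge0.
Qed.

Lemma std_exponential_tail (X : Omega -> R) (c : R) :
  std_exponential P X -> (0 <= c)%R ->
  P [set w | (c < X w)%R] = (expR (- c))%:E.
Proof.
move=> [mX XE] c0.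
have mle : measurable [set w | (X w <= c)%R].
  by rewrite -[X in measurable X]setTI; exact: measurable_fun_le.
rewrite (_ : [set w | (c < X w)%R] = ~` [set w | (X w <= c)%R]); last first.
  by apply/seteqP; split => w /=; rewrite ltNge => /negP.
rewrite probability_setC// XE c0 -EFinB; congr EFin; ring.
Qed.

(** The [k]-th factor only sees a Bernoulli variable of parameter [p k], coded below by a mass
    function that vanishes from [2] on; its generating function is [1 - p k + z * p k]. *)
Lemma independent_thinning (Z : Omega -> nat -> R) (B : nat -> set R) (p : nat -> R)
    (z : R) (K : nat) :
  (forall k, measurable_fun setT (Z ^~ k)) ->
  (forall C : nat -> set R, (forall k, measurable (C k)) ->
    P (\big[setI/setT]_(k < K) (Z ^~ k @^-1` C k)) =
    \prod_(k < K) P (Z ^~ k @^-1` C k)) ->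
  (forall k, measurable (B k)) ->
  (forall k, P (Z ^~ k @^-1` B k) = (p k)%:E) -> (0 <= z)%R ->
  \int[P]_w (\prod_(k < K) z ^+ (Z w k \in B k))%:E =
  (\prod_(k < K) (1 - (1 - z) * p k))%:E.
Proof.
move=> mZ Zind mB PB z0.
have p01 k : (0 <= p k <= 1)%R.
  rewrite -!lee_fin -PB measure_ge0 probability_le1//.
  by rewrite -[X in measurable X]setTI; exact: mZ.
have p0 k l : (0 <= match l with 0 => 1 - p k | 1 => p k | _ => 0 end)%R.
  by case: l => [|[|l]]//; have /andP[] := p01 k; rewrite ?subr_ge0.
apply: (@integral_prod_independent _ _ _ P K (fun w k => (Z w k \in B k) : nat)
  (fun k l => match l with 0 => 1 - p k | 1 => p k | _ => 0 end)%R
  (fun k l => z ^+ l)%R (fun k => 1 - (1 - z) * p k)%R) => [k|k l|k l|l|k].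
- apply: (@measurableT_comp _ _ _ _ _ _ nat_of_bool) => //.
  apply: (@measurable_fun_bool _ _ _ _ true) => /=.
  rewrite setTI (_ : _ @^-1` _ = Z ^~ k @^-1` B k); last first.
    by apply/seteqP; split => w /= => [/set_mem|/mem_set].
  by rewrite -[X in measurable X]setTI; exact: mZ.
- exact: p0.
- by rewrite exprn_ge0.
- pose C k : set R := match l k with 0 => ~` B k | 1 => B k | _ => set0 end.
  have mC k : measurable (C k).
    by rewrite /C; case: (l k) => [|[|]]//; exact: measurableC.
  transitivity (P (\big[setI/setT]_(k < K) (Z ^~ k @^-1` C k))).
    congr (P _); apply: eq_bigr => k _; apply/seteqP; split => w /=; rewrite /C;
      case: (l k) => [|[|i]] /=; case: (boolP (Z w k \in B k)); rewrite ?notin_setE ?inE//.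
  rewrite Zind// -prodEFin; apply: eq_bigr => k _; rewrite /C.
  case: (l k) => [|[|i]] //; last by rewrite preimage_set0 measure0.
  rewrite preimage_setC probability_setC ?PB//.
  by rewrite -[X in measurable X]setTI; exact: mZ.
- rewrite (@nneseries_split _ _ 0 2)//; last first.
    by move=> i _; rewrite lee_fin mulr_ge0 ?exprn_ge0.
  rewrite add0n big_nat_recr//= big_nat_recr//= big_geq// eseries0 ?adde0; last first.
    by move=> [|[|i]]// _ _; rewrite mulr0.
  rewrite -!EFinD; congr EFin; ring.
Qed.
End thinning.

(** * Right-continuous and cadlag paths *)

Section measurable_indexing.
Context {d d' : measure_display} {T : measurableType d} {U : measurableType d'}.

Lemma measurable_fun_nat_index (N : T -> nat) (F : nat -> T -> U) :
  measurable_fun setT N -> (forall k, measurable_fun setT (F k)) ->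
  measurable_fun setT (fun w => F (N w) w).
Proof.
move=> mN mF _ Y mY; rewrite setTI.
rewrite [_ @^-1` _](_ : _ = \bigcup_k (N @^-1` [set k] `&` F k @^-1` Y)).
  apply: bigcupT_measurable => k; apply: measurableI.
    exact: measurable_nat_preimage.
  by rewrite -[X in measurable X]setTI; exact: mF.
apply/seteqP; split => [w /= FY|w [k _ [/= <-]]//]; first by exists (N w).
Qed.

Lemma measurable_fun_nat_le (N : T -> nat) :
  (forall k, measurable [set w | (N w <= k)%N]) -> measurable_fun setT N.
Proof.
move=> mN; apply: measurable_fun_nat_valued => -[|k].
  rewrite (_ : [set w | _] = [set w | (N w <= 0)%N])//.
  by apply/seteqP; split => w /=; rewrite leqn0 => /eqP.
rewrite (_ : [set w | _] = [set w | (N w <= k.+1)%N] `\` [set w | (N w <= k)%N]).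
  exact: measurableD.
apply/seteqP; split => w /=; first by move=> ->; rewrite ltnn.
by case=> Nk /negP; rewrite -ltnNge => kN; apply/eqP; rewrite eqn_leq Nk.
Qed.
End measurable_indexing.

Section right_continuity.
Context {R : realType}.

Lemma measurable_truncn : measurable_fun setT (@Num.truncn R).
Proof.
apply: measurable_fun_nat_le => k.
rewrite (_ : [set x | _] = `]-oo, k.+1%:R[%classic); first exact: measurable_itv.
by apply/seteqP; split => x /=; rewrite in_itv/= truncn_le_nat.
Qed.

Lemma right_cvg_seq (h : R -> R) (s : R) (u : nat -> R) :
  h x @[x --> s^'+] --> h s -> (forall m, s <= u m) -> u @ \oo --> s ->
  h (u m) @[m --> \oo] --> h s.
Proof.
move=> hs su us; apply/cvgrPdist_lt => e e0.
move/cvgrPdist_lt : hs => /(_ e e0); rewrite near_withinE => /us near_u.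
near=> m; have := su m; rewrite le_eqVlt => /orP[/eqP <-|].
  by rewrite subrr normr0.
by near: m.
Unshelve. all: by end_near. Qed.

(** A time is approximated by the next point strictly to its right in the lattice of mesh
    [1 / m.+1], so that only countably many time sections occur. Nothing is assumed at negative
    times, hence the truncation [Num.max z.2 0]. *)
Lemma measurable_right_continuous {d : measure_display} {T : measurableType d}
    (h : T -> R -> R) :
  (forall s, 0 <= s -> measurable_fun setT (h ^~ s)) ->
  (forall x s, 0 <= s -> h x r @[r --> s^'+] --> h x s) ->
  measurable_fun setT (fun z : T * R => h z.1 (Num.max z.2 0)).
Proof.
move=> mh rh.
pose N m (z : T * R) := Num.truncn (Num.max z.2 0 * m.+1%:R).
apply: (@measurable_fun_cvg _ _ _ _ (fun m (z : T * R) => h z.1 ((N m z).+1%:R / m.+1%:R))).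
- move=> m; apply: (measurable_fun_nat_index (N m)
    (fun k (z : T * R) => h z.1 (k.+1%:R / m.+1%:R))) => [|k].
    apply: (@measurableT_comp _ _ _ _ _ _ (@Num.truncn R)).
      exact: measurable_truncn.
    apply: measurable_funM => //; apply: measurable_maxr => //.
  by apply: (@measurableT_comp _ _ _ _ _ _ (h ^~ (k.+1%:R / m.+1%:R))) => //; exact: mh.
- move=> z _; set s := Num.max z.2 0.
  have s0 : 0 <= s by rewrite le_max lexx orbT.
  apply: right_cvg_seq; first exact: rh.
    move=> m; rewrite ler_pdivlMr//; apply/ltW; exact: truncnS_gt.
  apply: (@squeeze_cvgr _ _ _ _ (fun=> s) (fun m => s + m.+1%:R^-1)).
  - near=> m; rewrite ler_pdivlMr//; apply/andP; split.
      by apply/ltW; exact: truncnS_gt.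
    rewrite ler_pdivrMr// mulrDl mulVf// -natr1 lerD2r.
    by rewrite truncn_le mulr_ge0.
  - exact: cvg_cst.
  - rewrite -[X in _ --> X]addr0; apply: cvgD; first exact: cvg_cst.
    exact: cvg_harmonic.
Unshelve. all: by end_near. Qed.

End right_continuity.

Section cadlag_real.
Context {R : realType}.
Local Notation mu := (@lebesgue_measure R).

Lemma cadlag_comp {E : topologicalType} (g : E -> R) (f : R -> E) :
  continuous g -> cadlag f -> cadlag (g \o f).
Proof.
move=> cg [rf lf]; split => s s0; first exact: (cvg_comp _ _ (rf s s0) (cg _)).
by have [l fl] := lf s s0; exists (g l); exact: (cvg_comp _ _ fl (cg _)).
Qed.

(** One-sided limits bound [h] near each point, and compactness of the segment makes the bound
    uniform. At time [0] there is no left limit, but points to the left are excluded by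
    [0 <= s']. *)
Lemma cadlag_bounded (h : R -> R) (t : R) : cadlag h ->
  exists2 B, 0 <= B & forall s, 0 <= s <= t -> `|h s| <= B.
Proof.
move=> [rh lh].
have : \forall i \near \oo, `[0, t] `<=` (fun s => 0 <= s -> `|h s| <= i%:R).
  apply: (iffLR (compact_near_coveringP _) (@segment_compact R 0 t)).
  move=> s; rewrite /= in_itv/= => /andP[s0 _].
  have [C nC] : exists C, \forall s' \near s, 0 <= s' -> `|h s'| <= C.
    have [C1 nC1] : exists C, \forall s' \near s, s < s' -> `|h s'| <= C.
      exists (`|h s| + 1).
      have /cvgrPdist_le/(_ 1 ltr01) := rh s s0.
      rewrite near_withinE => H.
      near=> s' => lts; have ss' : `|h s - h s'| <= 1 by exact: (near H s').
      rewrite -lerBlDl (le_trans _ ss')// distrC.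
      exact: (le_trans (lerB_dist _ _)).
    have [C2 nC2] : exists C, \forall s' \near s, s' < s -> 0 <= s' -> `|h s'| <= C.
      move: s0; rewrite le_eqVlt => /predU1P[<-|s0].
        by exists 0; near=> s' => s'0; rewrite leNgt s'0.
      have [l hl] := lh s s0; exists (`|l| + 1).
      have /cvgrPdist_le/(_ 1 ltr01) := hl.
      rewrite near_withinE => H.
      near=> s' => lts _; have ss' : `|l - h s'| <= 1 by exact: (near H s').
      rewrite -lerBlDl (le_trans _ ss')// distrC.
      exact: (le_trans (lerB_dist _ _)).
    exists (Num.max `|h s| (Num.max C1 C2)).
    near=> s' => s'0; rewrite !le_max; have [ss'|s's|<-] := ltgtP s s'.
    - by rewrite (near nC1 s')// orbT.
    - by rewrite (near nC2 s')// !orbT.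
    - by rewrite lexx.
  near=> s' i => /= s'0.
  apply: (@le_trans _ _ C); first exact: (near nC s').
  near: i; exact: nbhs_infty_ger.
move=> [n _ /(_ n (leqnn n)) nB].
exists n%:R => // s /andP[s0 st]; apply: nB => //=.
by rewrite in_itv/= s0 st.
Unshelve. all: by end_near. Qed.

Lemma cadlag_measurable (h : R -> R) (D : set R) :
  cadlag h -> D `<=` [set x | 0 <= x] -> measurable D -> measurable_fun D h.
Proof.
move=> [rh _] D0 mD.
have mh : measurable_fun setT (fun s : R => h (Num.max s 0)).
  (* A constant family over the dummy space [nat] reduces the claim to joint measurability. *)
  have := @measurable_right_continuous R _ nat (fun=> h) (fun _ _ => measurable_cst _)
    (fun _ => rh).
  set g := (fun z => _) => mg.
  exact: (measurable_fun_pair2 0%N mg).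
apply: (eq_measurable_fun (fun s : R => h (Num.max s 0))).
  by move=> x; rewrite inE => /D0/= x0; rewrite max_l.
exact: measurable_funTS.
Qed.

Lemma bounded_integrable (h : R -> R) (a b B : R) :
  measurable_fun `[a, b] h -> (forall s, a <= s <= b -> `|h s| <= B) ->
  mu.-integrable `[a, b] (EFin \o h).
Proof.
move=> mh hB; apply: measurable_bounded_integrable => //.
  rewrite /= lebesgue_measure_itv/=; case: ifP => _; rewrite ?ltry//.
exists B; split; first exact: num_real.
by move=> M BM s /=; rewrite in_itv/= => /hB /le_trans; apply; exact: ltW.
Qed.

Lemma cadlag_integrable (h : R -> R) (a b : R) :
  0 <= a -> cadlag h -> mu.-integrable `[a, b] (EFin \o h).
Proof.
move=> a0 ch; have [B _ hB] := cadlag_bounded h b ch.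
apply: (bounded_integrable _ _ _ B).
  apply: cadlag_measurable => // x /=; rewrite in_itv/= => /andP[+ _].
  exact: le_trans.
by move=> s /andP[/(le_trans a0) s0 sb]; rewrite hB// s0.
Qed.

Lemma Rint_split (h : R -> R) (a b c : R) : a <= b -> b <= c ->
  mu.-integrable `[a, c] (EFin \o h) -> Defs.Rint a c h = Defs.Rint a b h + Defs.Rint b c h.
Proof.
move=> ab bc ih; rewrite /Defs.Rint -(@Rintegral_itv_obnd_cbnd _ b (BRight c)); last first.
  by apply: integrableS ih => //; apply: subset_itvr; rewrite bnd_simp.
by rewrite -(@Rintegral_itvB _ _ (BLeft a) (BRight c))// ?bnd_simp// addrC subrK.
Qed.

Lemma Rint_ge0 (h : R -> R) (a b : R) :
  (forall s, a <= s <= b -> 0 <= h s) -> 0 <= Defs.Rint a b h.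
Proof. by move=> h0; apply: Rintegral_ge0 => s /=; rewrite in_itv/= => /h0. Qed.

Lemma Rint_norm_le (h : R -> R) (a b B : R) : a <= b ->
  mu.-integrable `[a, b] (EFin \o h) -> (forall s, a <= s <= b -> `|h s| <= B) ->
  `|Defs.Rint a b h| <= B * (b - a).
Proof.
move=> ab ih hB; apply: le_trans (le_normr_Rintegral _ _) _ => //.
have -> : B * (b - a) = \int[mu]_(x in `[a, b]) B.
  rewrite Rintegral_cst//= lebesgue_measure_itv/= lte_fin.
  by case: ltgtP ab => //= -> _; rewrite subrr !mulr0.
apply: le_Rintegral => //.
- exact: integrable_norm ih.
- apply: (bounded_integrable _ _ _ `|B|) => [|s _]; last by [].
  exact: measurable_cst.
Qed.

Lemma Rint_right_cvg (h : R -> R) (t s : R) (u : nat -> R) : cadlag h ->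
  0 <= s -> (forall m, s <= u m <= t) -> u @ \oo --> s ->
  Defs.Rint (u m) t h @[m --> \oo] --> Defs.Rint s t h.
Proof.
move=> ch s0 sut us; have [B B0 hB] := cadlag_bounded h t ch.
have ih : mu.-integrable `[s, t] (EFin \o h) by exact: cadlag_integrable.
rewrite (_ : (fun m => _) = (fun m => Defs.Rint s t h - Defs.Rint s (u m) h)); last first.
  apply/funext => m; have /andP[su ut] := sut m.
  by rewrite (Rint_split _ _ _ _ su ut ih) [RHS]addrAC subrr add0r.
rewrite -[X in _ --> X]subr0; apply: cvgB; first exact: cvg_cst.
apply: (@squeeze_cvgr _ _ _ _ (fun m => - (B * (u m - s))) (fun m => B * (u m - s))).
- near=> m; have /andP[su ut] := sut m.
  rewrite -ler_norml; apply: Rint_norm_le => //.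
    exact: cadlag_integrable.
  move=> r /andP[sr ru]; rewrite hB// (le_trans s0 sr)/=.
  exact: le_trans ut.
- rewrite -oppr0; apply: cvgN; rewrite -[X in _ --> X](mulr0 B); apply: cvgMr.
  by rewrite -(subrr s); apply: cvgB => //; exact: cvg_cst.
- rewrite -[X in _ --> X](mulr0 B); apply: cvgMr.
  by rewrite -(subrr s); apply: cvgB => //; exact: cvg_cst.
Unshelve. all: by end_near. Qed.

End cadlag_real.

(** * Grid approximation of jump times *)

Section counting.

(** For an antitone predicate the number of true values is the index at which it switches off, or
    [M] if it does not. Such counts, measurable by nature, serve below to locate grid cells. *)
Lemma antitone_count (b : nat -> bool) (M : nat) :
  (forall i j, (i <= j)%N -> b j -> b i) ->
  (\sum_(j < M) b j <= M)%N /\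
  forall j, (j < M)%N -> b j = (j < \sum_(j < M) b j)%N.
Proof.
move=> bmono; elim: M => [|M [IHle IH]]; first by rewrite big_ord0.
rewrite big_ord_recr/=; case bM : (b M).
  have cM : (\sum_(j < M) b j)%N = M.
    rewrite (eq_bigr (fun=> 1%N)) ?sum1_card ?card_ord// => i _.
    by rewrite (bmono i M)// ltnW.
  rewrite cM addn1; split => // j jM; rewrite jM; apply: bmono bM.
  by rewrite -ltnS.
rewrite addn0; split; first exact: leqW.
move=> j; rewrite ltnS leq_eqVlt => /predU1P[->|/IH//].
by rewrite bM ltnNge IHle.
Qed.

(** Items are grouped by cell: [k] belongs to the cell [i] with [A i <= k < A i.+1], and there the
    count of the [j] with [A j <= k] is [i.+1]. *)
Lemma prod_increments (R : comNzRingType) (A : nat -> nat) (q : nat -> R) (M : nat) :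
  A 0%N = 0%N -> (forall i j, (i <= j)%N -> (A i <= A j)%N) ->
  \prod_(i < M) q i.+1 ^+ (A i.+1 - A i) =
  \prod_(k < A M) q (\sum_(j < M) (A j <= k)%N)%N.
Proof.
move=> A0 Amono.
pose c k := (\sum_(j < M) (A j <= k)%N)%N.
suff claim j : (j <= M)%N -> \prod_(i < j) q i.+1 ^+ (A i.+1 - A i) =
    \prod_(0 <= k < A j) q (c k) by rewrite claim// big_mkord.
elim: j => [_|j IH jM]; first by rewrite A0 big_ord0 big_nil.
rewrite big_ord_recr/= IH ?(ltnW jM)// (@big_cat_nat _ _ _ (A j) 0 (A j.+1))//=; last first.
  exact: Amono.
congr (_ * _); rewrite -prodr_const_nat; apply: eq_big_nat => k /andP[jk kj].
have [cM bc] : (c k <= M)%N /\ forall i, (i < M)%N -> (A i <= k)%N = (i < c k)%N.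
  by apply: antitone_count => i i' ii'; apply: leq_trans; exact: Amono.
congr (q _); apply/eqP; rewrite eqn_leq -bc// jk /=.
move: jM; rewrite leq_eqVlt => /predU1P[->//|jM].
by rewrite leqNgt -bc// leqNgt kj.
Qed.
End counting.

Lemma measurable_count {d : measure_display} {T : measurableType d}
    (b : nat -> T -> bool) (M : nat) :
  (forall j, measurable_fun setT (b j)) ->
  measurable_fun setT (fun w => \sum_(j < M) b j w)%N.
Proof.
move=> mb; elim: M => [|M IH].
  by under eq_fun do rewrite big_ord0; exact: measurable_cst.
under eq_fun do rewrite big_ord_recr/=; apply: measurable_fun_addn => //.
by apply: (@measurableT_comp _ _ _ _ _ _ nat_of_bool).
Qed.

Lemma cvg_bigprod (R : realType) (I : Type) (r : seq I) (f : nat -> I -> R) (g : I -> R) :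
  (forall i, f m i @[m --> \oo] --> g i) ->
  \prod_(i <- r) f m i @[m --> \oo] --> \prod_(i <- r) g i.
Proof.
move=> fg; elim: r => [|i r IH].
  rewrite big_nil; under eq_fun do rewrite big_nil; exact: cvg_cst.
rewrite big_cons; under eq_fun do rewrite big_cons; exact: cvgM.
Qed.

Section grid.
Context {R : realType}.
Implicit Types t r : R.

Definition grid t (M i : nat) : R := t * i%:R / M%:R.

Lemma grid0 t M : grid t M 0 = 0.
Proof. by rewrite /grid mulr0 mul0r. Qed.

Lemma gridM t M : grid t M.+1 M.+1 = t.
Proof. by rewrite /grid mulfK. Qed.

Lemma gridS t M i : grid t M i.+1 = grid t M i + t / M%:R.
Proof. by rewrite /grid -natr1 mulrDr mulr1 mulrDl. Qed.

Lemma grid_le t M i j : 0 <= t -> (i <= j)%N -> grid t M i <= grid t M j.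
Proof.
by move=> t0 ij; rewrite /grid ler_wpM2r ?invr_ge0// ler_wpM2l// ler_nat.
Qed.

Lemma grid_ge0 t M i : 0 <= t -> 0 <= grid t M i.
Proof. by move=> t0; rewrite -(grid0 t M); exact: grid_le. Qed.

Lemma cvg_gridsize t : t / m.+1%:R @[m --> \oo] --> (0 : R).
Proof. by rewrite -[X in _ --> X](mulr0 t); apply: cvgMr; exact: cvg_harmonic. Qed.

(* The right end of the grid cell containing the point at which the antitone
   predicate [b] switches from true to false. *)
Lemma grid_count_squeeze t M (b : nat -> bool) (r : R) : 0 <= t ->
  b 0%N -> (forall i j, (i <= j)%N -> b j -> b i) ->
  (forall i, b i -> grid t M.+1 i <= r) ->
  (forall i, ~~ b i -> r <= grid t M.+1 i) -> r <= t ->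
  let s := grid t M.+1 (\sum_(j < M.+1) b j) in
  [/\ r <= s, s <= t & s <= r + t / M.+1%:R].
Proof.
move=> t0 b0 bmono br nbr rt s.
have [cM bc] := antitone_count b M.+1 bmono.
have st : s <= t by rewrite -[leRHS](gridM t M); exact: grid_le.
have c0 : (0 < \sum_(j < M.+1) b j)%N by rewrite -bc.
split => //.
- move: cM; rewrite /s leq_eqVlt => /predU1P[->|cM]; first by rewrite gridM.
  by apply: nbr; rewrite bc// ltnn.
- rewrite /s -(prednK c0) gridS lerD2r; apply: br.
  by rewrite bc prednK// (leq_trans _ cM)// prednK.
Qed.

(** This asks for just what grid approximations deliver: sequences that may equal [s] and that stay
    within the horizon [t]. *)
Definition right_seq_continuous t (q : R -> R) :=
  forall s (u : nat -> R), 0 <= s -> (forall m, s <= u m <= t) -> u @ \oo --> s ->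
  q (u m) @[m --> \oo] --> q s.

Section arrivals.
Variables (t : R) (A : R -> nat).
Hypotheses (t0 : 0 <= t) (A0 : A 0 = 0%N).
Hypothesis Amono : forall r s, 0 <= r -> r <= s -> (A r <= A s)%N.

(** With [A] the arrival count this is convertible to [arrival_time]. The condition [k < A t] of the
    lemmas below keeps the set nonempty, away from the default value of [inf]. *)
Definition jump_time k : R := inf [set u | 0 <= u /\ (k < A u)%N].

(** The right end of the cell in which level [k] is passed, read off from [A] at grid points alone;
    this is what makes it measurable in the randomness. *)
Definition grid_jump_time m k : R :=
  grid t m.+1 (\sum_(j < m.+1) (A (grid t m.+1 j) <= k)%N).

Lemma jump_time_ge0 k : (k < A t)%N -> 0 <= jump_time k.
Proof.
by move=> kt; apply: lb_le_inf; [exists t|move=> u []].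
Qed.

Lemma jump_time_le k u : 0 <= u -> (k < A u)%N -> jump_time k <= u.
Proof. by move=> u0 ku; apply: ge_inf => //; exists 0 => v []. Qed.

Lemma jump_time_ge k u : (k < A t)%N -> (A u <= k)%N -> u <= jump_time k.
Proof.
move=> kt uk; apply: lb_le_inf; first by exists t.
move=> v [v0 kv]; rewrite leNgt; apply/negP => vu.
by move: (leq_trans kv (Amono _ _ v0 (ltW vu))); rewrite ltnNge uk.
Qed.

Lemma grid_jump_time_squeeze m k : (k < A t)%N ->
  [/\ jump_time k <= grid_jump_time m k, grid_jump_time m k <= t &
      grid_jump_time m k <= jump_time k + t / m.+1%:R].
Proof.
move=> kt; apply: (grid_count_squeeze t m (fun j => (A (grid t m.+1 j) <= k)%N)) => //.
- by rewrite grid0 A0.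
- move=> i j ij; apply: leq_trans; apply: Amono; [exact: grid_ge0|exact: grid_le].
- by move=> i; exact: jump_time_ge.
- by move=> i; rewrite -ltnNge; apply: jump_time_le; exact: grid_ge0.
- exact: jump_time_le.
Qed.

Lemma grid_jump_time_cvg k : (k < A t)%N ->
  grid_jump_time m k @[m --> \oo] --> jump_time k.
Proof.
move=> kt.
apply: (@squeeze_cvgr _ _ _ _ (fun=> jump_time k) (fun m => jump_time k + t / m.+1%:R)).
- by near=> m; have [-> _ ->] := grid_jump_time_squeeze m k kt.
- exact: cvg_cst.
- rewrite -[X in _ --> X]addr0; apply: cvgD; [exact: cvg_cst|exact: cvg_gridsize].
Unshelve. all: by end_near. Qed.

(** Several jumps may share a cell: the power of [q] at its right end accounts for all of them, and
    each jump time is approached from the right as the mesh shrinks. *)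
Lemma prod_jump_times_cvg (q : R -> R) : right_seq_continuous t q ->
  \prod_(i < m.+1) q (grid t m.+1 i.+1) ^+
    (A (grid t m.+1 i.+1) - A (grid t m.+1 i))%N @[m --> \oo] -->
  \prod_(k < A t) q (jump_time k).
Proof.
move=> qr.
rewrite (_ : (fun m => _) = (fun m => \prod_(k < A t) q (grid_jump_time m k))); last first.
  apply/funext => m.
  rewrite (@prod_increments _ (fun i => A (grid t m.+1 i)) (fun i => q (grid t m.+1 i))).
  - by rewrite gridM.
  - by rewrite grid0.
  - by move=> i j ij; apply: Amono; [exact: grid_ge0|exact: grid_le].
have cvg_k (k : 'I_(A t)) : q (grid_jump_time m k) @[m --> \oo] --> q (jump_time k).
  apply: qr; first exact: jump_time_ge0.
    by move=> m; have [-> -> _] := grid_jump_time_squeeze m k (ltn_ord k).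
  exact: grid_jump_time_cvg.
exact: cvg_bigprod.
Qed.
End arrivals.

Local Notation mu := (@lebesgue_measure R).

Definition grid_right t (m : nat) (r : R) : R :=
  grid t m.+1 (\sum_(j < m.+1) (grid t m.+1 j <= r)%R)%N.

Lemma grid_right_squeeze t m r : 0 <= r <= t ->
  [/\ r <= grid_right t m r, grid_right t m r <= t &
      grid_right t m r <= r + t / m.+1%:R].
Proof.
move=> /andP[r0 rt]; have t0 := le_trans r0 rt.
apply: (grid_count_squeeze t m (fun j => grid t m.+1 j <= r)) => //.
- by rewrite grid0.
- move=> i j ij; apply: le_trans; exact: grid_le.
- by move=> i; rewrite -ltNge => /ltW.
Qed.

Lemma grid_right_cvg t r : 0 <= r <= t -> grid_right t m r @[m --> \oo] --> r.
Proof.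
move=> rt.
apply: (@squeeze_cvgr _ _ _ _ (fun=> r) (fun m => r + t / m.+1%:R)).
- by near=> m; have [-> _ ->] := grid_right_squeeze t m r rt.
- exact: cvg_cst.
- rewrite -[X in _ --> X]addr0; apply: cvgD; [exact: cvg_cst|exact: cvg_gridsize].
Unshelve. all: by end_near. Qed.

Lemma grid_right_cell t m i r : 0 <= t -> (i < m.+1)%N ->
  grid t m.+1 i <= r -> r < grid t m.+1 i.+1 ->
  grid_right t m r = grid t m.+1 i.+1.
Proof.
move=> t0 im ir ri; congr (grid _ _ _).
have [cM bc] : (\sum_(j < m.+1) (grid t m.+1 j <= r)%R <= m.+1)%N /\
    forall j, (j < m.+1)%N ->
      (grid t m.+1 j <= r) = (j < \sum_(j < m.+1) (grid t m.+1 j <= r)%R)%N.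
  apply: (antitone_count (fun j => grid t m.+1 j <= r)).
  by move=> j j' jj'; apply: le_trans; exact: grid_le.
apply/eqP; rewrite eqn_leq -bc// ir andbT.
move: im; rewrite leq_eqVlt => /predU1P[[->]//|im].
by rewrite leqNgt -bc// -ltNge.
Qed.

Lemma measurable_comp_grid_right t m (w : R -> R) :
  measurable_fun setT (fun r => w (grid_right t m r)).
Proof.
apply: (measurable_fun_nat_index
  (fun r : R => \sum_(j < m.+1) (grid t m.+1 j <= r)%R)%N
  (fun k _ => w (grid t m.+1 k))) => [|k]; last exact: measurable_cst.
apply: (measurable_count (fun j (r : R) => grid t m.+1 j <= r)) => j.
exact: measurable_fun_ler.
Qed.

Lemma right_seq_continuous_measurable t (q : R -> R) :
  right_seq_continuous t q -> measurable_fun `[0, t] q.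
Proof.
move=> qr; apply: (@measurable_fun_cvg _ _ _ _ (fun m r => q (grid_right t m r))).
  by move=> m; apply: measurable_funTS; exact: measurable_comp_grid_right.
move=> r /=; rewrite in_itv/= => rt; apply: qr; first by have /andP[] := rt.
  by move=> m; have [-> -> _] := grid_right_squeeze t m r rt.
exact: grid_right_cvg.
Qed.

(** The factor is constant on a half-open interval only, because the grid step functions jump at the
    right end of a cell; a single point has no mass. *)
Lemma Rint_mul_cst (a h : R -> R) (c x y : R) : x <= y ->
  mu.-integrable `[x, y] (EFin \o a) -> mu.-integrable `[x, y] (EFin \o h) ->
  (forall r, x <= r < y -> h r = a r * c) ->
  Defs.Rint x y h = Defs.Rint x y a * c.
Proof.
move=> xy ia ih hac; rewrite /Defs.Rint.
have sub : `[x, y[ `<=` `[x, y] by apply: subset_itvl; rewrite bnd_simp.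
rewrite -(@Rintegral_itv_bndo_bndc _ (BLeft x) y h); last exact: integrableS ih.
rewrite -(@Rintegral_itv_bndo_bndc _ (BLeft x) y a); last exact: integrableS ia.
rewrite -RintegralZr//; last exact: integrableS ia.
by apply: eq_Rintegral => r; rewrite inE/= in_itv/= => /hac.
Qed.

Lemma Rint_grid_sum t m (a w : R -> R) (j : nat) : 0 <= t -> (j <= m.+1)%N ->
  mu.-integrable `[0, t] (EFin \o a) ->
  mu.-integrable `[0, t] (EFin \o (fun r => a r * w (grid_right t m r))) ->
  Defs.Rint 0 (grid t m.+1 j) (fun r => a r * w (grid_right t m r)) =
  \sum_(i < j) (Defs.Rint 0 (grid t m.+1 i.+1) a - Defs.Rint 0 (grid t m.+1 i) a) *
    w (grid t m.+1 i.+1).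
Proof.
move=> t0 jm ia iaw; elim: j jm => [_|j IH jm].
  by rewrite grid0 big_ord0 /Defs.Rint set_itv1 Rintegral_set1.
have gj : grid t m.+1 j <= grid t m.+1 j.+1 by exact: grid_le.
have gt : grid t m.+1 j.+1 <= t by rewrite -[leRHS](gridM t m); exact: grid_le.
have g0 : 0 <= grid t m.+1 j by exact: grid_ge0.
have sub1 : `[0, grid t m.+1 j.+1] `<=` `[0, t].
  by apply: subset_itvl; rewrite bnd_simp.
have sub2 : `[grid t m.+1 j, grid t m.+1 j.+1] `<=` `[0, t].
  by apply: subset_itv; rewrite bnd_simp.
rewrite (@Rint_split _ _ _ (grid t m.+1 j))//; last exact: integrableS iaw.
rewrite IH ?(ltnW jm)// big_ord_recr/=; congr (_ + _).
rewrite (@Rint_split _ a _ (grid t m.+1 j) (grid t m.+1 j.+1))//; last first.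
  exact: integrableS ia.
rewrite addrAC subrr add0r; apply: Rint_mul_cst => //.
- exact: integrableS ia.
- exact: integrableS iaw.
- by move=> r /andP[jr rj]; rewrite (grid_right_cell t m j).
Qed.

(** The sum is the integral of [a] against the step function [w (grid_right t m r)], and dominated
    convergence applies with the constant bound [C * B]. *)
Lemma Rint_grid_cvg t (a w : R -> R) (B : R) : 0 <= t -> cadlag a ->
  right_seq_continuous t w -> (forall s, 0 <= s <= t -> `|w s| <= B) ->
  \sum_(i < m.+1)
    (Defs.Rint 0 (grid t m.+1 i.+1) a - Defs.Rint 0 (grid t m.+1 i) a) *
    w (grid t m.+1 i.+1) @[m --> \oo] -->
  Defs.Rint 0 t (fun r => a r * w r).
Proof.
move=> t0 ca wr wB.
have B0 : 0 <= B by apply: le_trans (wB 0 _); rewrite ?normr_ge0 ?lexx.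
have [C C0 aC] := cadlag_bounded a t ca.
have ma : measurable_fun `[0, t] a.
  by apply: cadlag_measurable => // x /=; rewrite in_itv/= => /andP[].
pose h m r := a r * w (grid_right t m r).
have mh m : measurable_fun `[0, t] (h m).
  by apply: measurable_funM => //; apply: measurable_funTS; exact: measurable_comp_grid_right.
have hB m r : 0 <= r <= t -> `|h m r| <= C * B.
  move=> rt; rewrite normrM ler_pM// ?aC// wB//.
  have [rg -> _] := grid_right_squeeze t m r rt.
  by rewrite andbT (le_trans _ rg)//; have /andP[] := rt.
have h_cvg r : 0 <= r <= t -> h m r @[m --> \oo] --> a r * w r.
  move=> rt; apply: cvgMr; apply: wr; first by have /andP[] := rt.
    by move=> m; have [-> -> _] := grid_right_squeeze t m r rt.
  exact: grid_right_cvg.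
have maw : measurable_fun `[0, t] (fun r => a r * w r).
  by apply: measurable_funM => //; exact: right_seq_continuous_measurable.
have iC : mu.-integrable `[0, t] (EFin \o (fun=> C * B)).
  apply: (bounded_integrable _ _ _ (C * B)) => // s _.
  by rewrite ger0_norm// mulr_ge0.
have ia : mu.-integrable `[0, t] (EFin \o a) by exact: cadlag_integrable.
have ih m : mu.-integrable `[0, t] (EFin \o h m).
  by apply: (bounded_integrable _ _ _ (C * B)) => //; exact: hB.
rewrite (_ : (fun m => _) = (fun m => Defs.Rint 0 t (h m))); last first.
  apply/funext => m; rewrite -(Rint_grid_sum t m a w m.+1)// ?gridM//.
  exact: ih.
have [] := @dominated_convergence _ _ _ mu `[0, t] (measurable_itv _)
  (fun m => EFin \o h m) (EFin \o (fun r => a r * w r)) (EFin \o (fun=> C * B)).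
- by move=> m; apply/measurable_EFinP; exact: mh.
- exact/measurable_EFinP.
- apply: aeW => r /=; rewrite in_itv/= => rt; apply: cvg_EFin; first exact: nearW.
  exact: h_cvg.
- exact: iC.
- by apply: aeW => r m /=; rewrite in_itv/= lee_fin => rt; exact: hB.
move=> iaw _ Hcvg; apply: fine_cvg; rewrite fineK; first exact: Hcvg.
exact: integrable_fin_num.
Qed.
End grid.

(** This is the measurability part of Tonelli's theorem; as [0 <= a], truncating the time at [0]
    changes nothing on the domain of integration. *)
Lemma measurable_Rint {R : realType} {d : measure_display} {T : measurableType d}
    (h : T -> R -> R) (a b : R) : 0 <= a ->
  (forall s, 0 <= s -> measurable_fun setT (h ^~ s)) ->
  (forall x s, 0 <= s -> h x r @[r --> s^'+] --> h x s) ->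
  (forall x s, 0 <= h x s) ->
  measurable_fun setT (fun x => Defs.Rint a b (h x)).
Proof.
move=> a0 mh rh h0.
pose F (z : T * R) : \bar R := (h z.1 (Num.max z.2 0) * \1_`[a, b] z.2)%:E.
have mF : measurable_fun setT F.
  apply/measurable_EFinP; apply: measurable_funM.
    exact: measurable_right_continuous.
  by apply: (@measurableT_comp _ _ _ _ _ _ (\1_`[a, b] : R -> R)) => //.
have F0 z : (0 <= F z)%E by rewrite lee_fin mulr_ge0.
rewrite (_ : (fun x => _) = fine \o fubini_F (@lebesgue_measure R) F); last first.
  apply/funext => x; rewrite /= /fubini_F /Defs.Rint /Rintegral integral_mkcond.
  congr fine; apply: eq_integral => r _.
  rewrite patchE /F/= indicE; case: ifPn => [|_]; last by rewrite mulr0.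
  rewrite inE/= in_itv/= => /andP[ar _].
  by rewrite max_l ?mulr1// (le_trans a0).
apply: (@measurableT_comp _ _ _ _ _ _ (@fine R)) => //.
exact: measurable_fun_fubini_tonelli_F.
Qed.

(** * The conditional law of the queue length *)

Section poisson_jumps.
Context {d : measure_display} {Omega : measurableType d} {R : realType}.
Variables (P : probability Omega R) (Y : Omega -> R -> nat).
Hypothesis Ypoisson : std_poisson_process P Y.
Variables (t : R) (a : R -> R).
Hypotheses (t0 : 0 <= t) (ca : cadlag a) (a0 : forall s, 0 <= a s).
Let L u : R := Defs.Rint 0 u a.

Lemma cumulative_rate_le (u v : R) : 0 <= u -> u <= v -> L u <= L v.
Proof.
move=> u0 uv; rewrite /L (@Rint_split _ a 0 u v)//; last exact: cadlag_integrable.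
by rewrite lerDl; apply: Rint_ge0.
Qed.

Lemma cumulative_rate0 : L 0 = 0.
Proof. by rewrite /L /Defs.Rint set_itv1 Rintegral_set1. Qed.

(** The generating functional of a Poisson process with intensity [a], realised by time change. On a
    grid the product involves independent Poisson increments only; as the mesh shrinks, the
    exponents become the integral, and all products stay in [[0, 1]]. *)
Lemma poisson_jump_functional (q : R -> R) :
  right_seq_continuous t q -> (forall s, 0 <= s -> 0 <= q s <= 1) ->
  (\int[P]_w (\prod_(k < Y w (L t)) q (jump_time (fun u => Y w (L u)) k))%:E =
   (expR (Defs.Rint 0 t (fun r => a r * (q r - 1))))%:E)%E.
Proof.
move=> qr q01; have [Y0 [Ymono [_ [mY _]]]] := Ypoisson.
pose g m i := grid t m.+1 i.
have g0 m i : 0 <= g m i by exact: grid_ge0.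
pose h m w : R := \prod_(i < m.+1) q (g m i.+1) ^+ (Y w (L (g m i.+1)) - Y w (L (g m i)))%N.
have mh m : measurable_fun setT (h m).
  apply: measurable_prod => i _.
  apply: (@measurableT_comp _ _ _ _ _ _ (fun k => q (g m i.+1) ^+ k)) => //.
  by apply: measurable_fun_subn; apply: measurable_fun_nat_valued => k; exact: mY.
have h_cvg w : h m w @[m --> \oo] -->
    \prod_(k < Y w (L t)) q (jump_time (fun u => Y w (L u)) k).
  apply: (prod_jump_times_cvg t (fun u => Y w (L u))) => //.
  - by rewrite cumulative_rate0 Y0.
  - move=> r s r0 rs; apply: Ymono; last exact: cumulative_rate_le.
    by rewrite -cumulative_rate0; exact: cumulative_rate_le.
have h01 m w : 0 <= h m w <= 1.
  have q0 i : 0 <= q (g m i) by have /andP[] := q01 _ (g0 m i).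
  apply/andP; split; first by apply: prodr_ge0 => i _; rewrite exprn_ge0.
  apply: Num.Theory.prodr_ile1 => i _; rewrite exprn_ge0//=.
  by rewrite exprn_ile1//; have /andP[] := q01 _ (g0 m i.+1).
have Eh m : (\int[P]_w (h m w)%:E = (expR (\sum_(i < m.+1)
    (L (g m i.+1) - L (g m i)) * (q (g m i.+1) - 1)))%:E)%E.
  rewrite (poisson_increments_pow P Y (fun i => L (g m i)) (fun i => q (g m i.+1)) m.+1)//.
  - by rewrite expR_sum.
  - by rewrite /g grid0 cumulative_rate0.
  - by move=> i; apply: cumulative_rate_le => //; exact: grid_le.
  - by move=> i; have /andP[] := q01 _ (g0 m i.+1).
pose H w := \prod_(k < Y w (L t)) q (jump_time (fun u => Y w (L u)) k).
(* Measurability is inherited from the grid products, which involve finitely many times. *)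
have mH : measurable_fun setT H.
  by apply: (@measurable_fun_cvg _ _ _ _ h) => // w _; exact: h_cvg.
have [] := @dominated_convergence _ _ _ P setT measurableT
  (fun m => EFin \o h m) (EFin \o H) (EFin \o (fun=> 1)).
- by move=> m; apply/measurable_EFinP; exact: mh.
- exact/measurable_EFinP.
- apply: aeW => w _; apply: cvg_EFin; first exact: nearW.
  exact: h_cvg.
- exact: finite_measure_integrable_cst.
- apply: aeW => w m _ /=; rewrite lee_fin ger0_norm; have /andP[] := h01 m w => //.
move=> _ _ Hcvg; apply: (cvg_unique _ Hcvg) => //.
rewrite (_ : (fun m => _) = (fun m => (expR (\sum_(i < m.+1)
    (L (g m i.+1) - L (g m i)) * (q (g m i.+1) - 1)))%:E)); last first.
  by apply/funext => m; exact: Eh.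
apply: cvg_EFin; first exact: nearW.
apply: continuous_cvg; first exact: continuous_expR.
apply: (@Rint_grid_cvg _ t a (fun s => q s - 1) 1) => //.
- by move=> s u s0 sut us; apply: cvgB; [exact: qr|exact: cvg_cst].
- move=> s /andP[s0 _]; have /andP[? ?] := q01 s s0.
  by rewrite ler_norml; apply/andP; split; lra.
Qed.
End poisson_jumps.

Section phi_integral.
Context {R : realType} {E : topologicalType}.
Variables (lam kap mu : E -> R) (t : R) (f : R -> E).
Hypotheses (lam_cont : continuous lam) (kap_cont : continuous kap)
  (mu_cont : continuous mu).
Hypotheses (lam_ge0 : forall x, 0 <= lam x) (kap_ge0 : forall x, 0 <= kap x)
  (mu_ge0 : forall x, 0 <= mu x).
Hypothesis f_cadlag : cadlag f.

Lemma phi_integrand_integrable :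
  (@lebesgue_measure R).-integrable `[0, t] (EFin \o (fun s => lam (f s) *
    expR (- kap (f s) * Defs.Rint s t (fun r => mu (f r))))).
Proof.
have ca : cadlag (lam \o f) := cadlag_comp lam f lam_cont f_cadlag.
have [C C0 aC] := cadlag_bounded _ t ca.
apply: (bounded_integrable _ _ _ C) => [|s /andP[s0 st]].
  apply: measurable_funM.
    by apply: cadlag_measurable => // s /=; rewrite in_itv/= => /andP[].
  apply: right_seq_continuous_measurable => s u s0 sut us.
  apply: continuous_cvg; first exact: continuous_expR.
  apply: cvgM.
    apply: cvgN; apply: (right_cvg_seq (kap \o f)) => //.
      by have [+ _] := cadlag_comp kap f kap_cont f_cadlag; apply.
    by move=> m; have /andP[] := sut m.
  by apply: Rint_right_cvg => //; exact: cadlag_comp.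
rewrite normrM -[leRHS]mulr1 ler_pM// ?aC ?s0// ger0_norm ?expR_ge0//.
by rewrite -expR0 ler_expR mulNr oppr_le0 mulr_ge0// Rint_ge0.
Qed.

Lemma phi_ge0 : 0 <= phi lam kap mu t f.
Proof. by apply: Rint_ge0 => s _; rewrite mulr_ge0// expR_ge0. Qed.

Lemma phi_scale (c : R) :
  phi (fun x => c * lam x) kap mu t f = c * phi lam kap mu t f.
Proof.
rewrite /phi /Defs.Rint -RintegralZl//; last exact: phi_integrand_integrable.
by apply: eq_Rintegral => s _; rewrite mulrA.
Qed.

End phi_integral.

(** * The queue count as a function of three separate sample points *)

Section queue_model.
Context {R : realType} {E : topologicalType}.
Variables (lam kap mu : E -> R).
Hypotheses (lam_cont : continuous lam) (kap_cont : continuous kap)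
  (mu_cont : continuous mu).
Hypotheses (lam_ge0 : forall x, 0 <= lam x) (kap_ge0 : forall x, 0 <= kap x)
  (mu_ge0 : forall x, 0 <= mu x).
Variable t : R.
Hypothesis t0 : 0 <= t.
Context {d1 d2 d3 : measure_display} {T1 : measurableType d1}
  {T2 : measurableType d2} {T3 : measurableType d3}.
Variables (J : T1 -> R -> E) (Y : T2 -> R -> nat) (Z : T3 -> nat -> R).
Hypothesis J_cadlag : forall x, cadlag (J x).
Hypothesis J_meas : forall s (B : set E), 0 <= s -> open B ->
  measurable ((fun x => J x s) @^-1` B).
Hypothesis Y0 : forall y, Y y 0 = 0%N.
Hypothesis Y_mono : forall y s u, 0 <= s -> s <= u -> (Y y s <= Y y u)%N.
Hypothesis Y_rc : forall y s, 0 <= s -> Y y x @[x --> s^'+] --> Y y s.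
Hypothesis Y_meas : forall s k, 0 <= s -> measurable [set y | Y y s = k].
Hypothesis Z_meas : forall k, measurable_fun setT (Z ^~ k).

Lemma measurable_continuous_J (g : E -> R) (s : R) :
  continuous g -> 0 <= s -> measurable_fun setT (fun x => g (J x s)).
Proof.
move=> cg s0; apply: (measurability _ (RGenOpens.measurableE R)) => //.
move=> /= _ [_ [a [b ->]] <-]; rewrite setTI.
apply: (J_meas s (g @^-1` `]a, b[)) => //.
by move/continuousP : cg; apply; exact: interval_open.
Qed.

Lemma J_right_continuous (g : E -> R) x s : continuous g -> 0 <= s ->
  g (J x r) @[r --> s^'+] --> g (J x s).
Proof. by move=> cg; have [+ _] := cadlag_comp g (J x) cg (J_cadlag x); apply. Qed.

Let A (z : T1 * T2) (u : R) : nat := arrival_count lam (J z.1) (Y z.2) u.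

Lemma arrival_count0 z : A z 0 = 0%N.
Proof. by rewrite /A /arrival_count [X in Y _ X]cumulative_rate0. Qed.

Lemma cumulated_rate_ge0 x u : 0 <= Defs.Rint 0 u (fun s => lam (J x s)).
Proof. exact: Rint_ge0. Qed.

Lemma arrival_count_mono z r s : 0 <= r -> r <= s -> (A z r <= A z s)%N.
Proof.
move=> r0 rs; apply: Y_mono; first exact: cumulated_rate_ge0.
by apply: cumulative_rate_le => //; exact: cadlag_comp (J_cadlag _).
Qed.

(** A Poisson path is read at a random time, which calls for joint measurability: [Y] is cast to the
    reals to use the lemma on right-continuous paths, and [Num.truncn] brings it back. *)
Lemma measurable_arrival_count u : measurable_fun setT (fun z => A z u).
Proof.
have mY : measurable_fun setT (fun w : T2 * R => (Y w.1 (Num.max w.2 0))%:R : R).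
  apply: (measurable_right_continuous (fun y s => (Y y s)%:R)) => [s s0|y s s0].
    apply: (@measurableT_comp _ _ _ _ _ _ (fun n : nat => n%:R : R)) => //.
    by apply: measurable_fun_nat_valued => k; exact: Y_meas.
  apply: (@cvg_comp _ _ _ (Y y) (fun n : nat => n%:R : R) _ (nbhs (Y y s))).
    exact: Y_rc.
  move=> B nB; apply: (filterS _ (discrete_set1 (Y y s))) => n /= ->.
  exact: nbhs_singleton.
have mL : measurable_fun setT
    (fun z : T1 * T2 => Defs.Rint 0 u (fun s => lam (J z.1 s))).
  apply: (@measurableT_comp _ _ _ _ _ _
    (fun x => Defs.Rint 0 u (fun s => lam (J x s)))) => //.
  apply: (measurable_Rint (fun x s => lam (J x s))) => //.
    by move=> s s0; exact: measurable_continuous_J.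
  by move=> x s s0; exact: J_right_continuous.
pose G (z : T1 * T2) := (z.2, Defs.Rint 0 u (fun s => lam (J z.1 s))).
have mG : measurable_fun setT G by exact: measurable_fun_pair.
rewrite (_ : (fun z => _) = @Num.truncn R \o
    (fun w : T2 * R => (Y w.1 (Num.max w.2 0))%:R) \o G); last first.
  apply/funext => z; rewrite /= natrK /A /arrival_count max_l//.
  exact: cumulated_rate_ge0.
apply: measurableT_comp => //; apply: measurableT_comp => //.
exact: measurable_truncn.
Qed.

(** The factor [(k < A z t)%N%:R] silences the sample points with at most [k] arrivals, where the
    grid times need not converge to [jump_time]. *)
Lemma measurable_at_jump_time (h : T1 -> R -> R) (k : nat) :
  (forall s, 0 <= s -> measurable_fun setT (h ^~ s)) ->
  (forall x, right_seq_continuous t (h x)) ->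
  measurable_fun setT
    (fun z => (k < A z t)%N%:R * h z.1 (jump_time (A z) k)).
Proof.
move=> mh rh; apply: (@measurable_fun_cvg _ _ _ _
  (fun m z => (k < A z t)%N%:R * h z.1 (grid_jump_time t (A z) m k))) => [m|z _].
- apply: measurable_funM.
    apply: (@measurableT_comp _ _ _ _ _ _ (fun b : bool => b%:R : R)) => //.
    by apply: measurable_fun_ltn => //; exact: measurable_arrival_count.
  apply: (measurable_fun_nat_index
    (fun z => \sum_(j < m.+1) (A z (grid t m.+1 j) <= k)%N)%N
    (fun i z => h z.1 (grid t m.+1 i))) => [|i].
    apply: (measurable_count (fun j z => A z (grid t m.+1 j) <= k)%N) => j.
    by apply: measurable_fun_leq => //; exact: measurable_arrival_count.
  apply: (@measurableT_comp _ _ _ _ _ _ (h ^~ (grid t m.+1 i))) => //.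
  by apply: mh; exact: grid_ge0.
- case: (ltnP k (A z t)) => kt; last first.
    by rewrite mul0r; under eq_fun do rewrite mul0r; exact: cvg_cst.
  rewrite mul1r; under eq_fun do rewrite mul1r.
  apply: rh; first by apply: (jump_time_ge0 t (A z)).
    move=> m; have [] // := grid_jump_time_squeeze t (A z) t0 (arrival_count0 z)
      (arrival_count_mono z) m k kt.
    by move=> -> ->.
  apply: grid_jump_time_cvg => //; first exact: arrival_count0.
  exact: arrival_count_mono.
Qed.

Let W x s : R := Defs.Rint s t (fun r => mu (J x r)).
Let D x s : R := kap (J x s).

Lemma W_ge0 x s : 0 <= W x s. Proof. exact: Rint_ge0. Qed.

Lemma W_right_seq x : right_seq_continuous t (W x).
Proof.
move=> s u s0 sut us; apply: Rint_right_cvg => //.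
exact: cadlag_comp (J_cadlag _).
Qed.

Lemma D_right_seq x : right_seq_continuous t (D x).
Proof.
move=> s u s0 sut us; apply: right_cvg_seq => //; first exact: J_right_continuous.
by move=> m; have /andP[] := sut m.
Qed.

Lemma W_meas s : 0 <= s -> measurable_fun setT (W ^~ s).
Proof.
move=> s0; apply: (measurable_Rint (fun x s => mu (J x s))) => //.
  by move=> r r0; exact: measurable_continuous_J.
by move=> x r r0; exact: J_right_continuous.
Qed.

Let Dk k z : R := (k < A z t)%N%:R * D z.1 (jump_time (A z) k).
Let Wk k z : R := (k < A z t)%N%:R * W z.1 (jump_time (A z) k).

Lemma measurable_Dk k : measurable_fun setT (Dk k).
Proof.
apply: measurable_at_jump_time; last exact: D_right_seq.
by move=> s s0; exact: measurable_continuous_J.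
Qed.

Lemma measurable_Wk k : measurable_fun setT (Wk k).
Proof.
apply: measurable_at_jump_time; last exact: W_right_seq.
exact: W_meas.
Qed.

(** The denominator of the requirement is cleared, so that both sides are visibly measurable; the
    zero case stays apart because division by zero returns zero, not infinity. *)
Let present k (v : (T1 * T2) * T3) : bool :=
  (Dk k v.1 == 0) || (Wk k v.1 * Dk k v.1 < Z v.2 k).

Definition model_count (v : (T1 * T2) * T3) : nat :=
  queue_count lam kap mu (J v.1.1) (Y v.1.2) (Z v.2) t.

Lemma model_countE v : model_count v = (\sum_(k < A v.1 t) present k v)%N.
Proof.
apply: eq_bigr => k _; congr nat_of_bool.
rewrite /present /Dk /Wk ltn_ord !mul1r; set s := jump_time (A v.1) k.
rewrite [LHS](_ : _ = (D v.1.1 s == 0) || (W v.1.1 s < Z v.2 k / D v.1.1 s))//.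
case: eqVneq => //= Ds0; rewrite ltr_pdivlMr//.
by rewrite lt_neqAle eq_sym Ds0 kap_ge0.
Qed.

Lemma measurable_model_count : measurable_fun setT model_count.
Proof.
rewrite (_ : model_count = fun v => \sum_(k < A v.1 t) present k v)%N; last first.
  by apply/funext; exact: model_countE.
apply: (measurable_fun_nat_index (fun v : (T1 * T2) * T3 => A v.1 t)
    (fun K v => \sum_(k < K) present k v)%N) => [|K].
  apply: (@measurableT_comp _ _ _ _ _ _ (fun z => A z t)) => //.
  exact: measurable_arrival_count.
apply: (measurable_count present) => k.
have mD : measurable_fun setT (fun v : (T1 * T2) * T3 => Dk k v.1).
  by apply: (@measurableT_comp _ _ _ _ _ _ (Dk k)) => //; exact: measurable_Dk.
have mW : measurable_fun setT (fun v : (T1 * T2) * T3 => Wk k v.1).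
  by apply: (@measurableT_comp _ _ _ _ _ _ (Wk k)) => //; exact: measurable_Wk.
apply: measurable_or; first exact: measurable_fun_eqr.
apply: measurable_fun_ltr; first exact: measurable_funM.
exact: (@measurableT_comp _ _ _ _ _ _ (Z ^~ k)).
Qed.

Context {d : measure_display} {Omega : measurableType d}.
Variables (P : probability Omega R).
Variables (X1 : Omega -> T1) (X2 : Omega -> T2) (X3 : Omega -> T3).
Hypotheses (mX1 : measurable_fun setT X1) (mX2 : measurable_fun setT X2)
  (mX3 : measurable_fun setT X3).
Hypotheses (X12 : independent_rv P X1 X2)
  (X123 : independent_rv P (fun w => (X1 w, X2 w)) X3).
Hypothesis YX_poisson : std_poisson_process P (Y \o X2).
Hypothesis ZX_exp : forall k, std_exponential P (fun w => Z (X3 w) k).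
Hypothesis ZX_indep : forall K (C : nat -> set R), (forall k, measurable (C k)) ->
  P (\big[setI/setT]_(k < K) ((fun w => Z (X3 w) k) @^-1` C k)) =
  (\prod_(k < K) P ((fun w => Z (X3 w) k) @^-1` C k))%E.

Let M w : nat := model_count ((X1 w, X2 w), X3 w).

Lemma measurable_M : measurable_fun setT M.
Proof.
apply: (@measurableT_comp _ _ _ _ _ _ model_count); first exact: measurable_model_count.
by apply: measurable_fun_pair => //; exact: measurable_fun_pair.
Qed.

(** Two layers are integrated out in turn: the marks with background and arrivals frozen, then the
    arrivals with the background frozen. Only an average over the background remains. *)
Lemma M_generating_function (z : R) : 0 <= z <= 1 ->
  (\int[P]_w (z ^+ M w)%:E =
   \int[P]_w (expR (phi lam kap mu t (J (X1 w)) * (z - 1)))%:E)%E.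
Proof.
move=> /andP[z0 z1].
have mz : measurable_fun setT (fun v => (z ^+ model_count v)%:E).
  apply/measurable_EFinP.
  apply: (@measurableT_comp _ _ _ _ _ _ (fun n : nat => z ^+ n)) => //.
  exact: measurable_model_count.
rewrite (decouple P _ _ _ _ (fun w => (X1 w, X2 w)) X3
  (fun v => (z ^+ model_count v)%:E))//; last 2 first.
- exact: measurable_fun_pair.
- by move=> v; rewrite lee_fin exprn_ge0.
pose p k v := expR (- (Wk k v * Dk k v)).
pose F v : \bar R := (\prod_(k < A v t) (1 - (1 - z) * p k v))%:E.
have WD0 k v : 0 <= Wk k v * Dk k v.
  by rewrite !mulr_ge0 ?W_ge0 ?kap_ge0.
have p01 k v : 0 <= p k v <= 1.
  by rewrite expR_ge0/= -expR0 ler_expR oppr_le0.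
transitivity (\int[P]_w F (X1 w, X2 w))%E.
  apply: eq_integral => w _; set v := (X1 w, X2 w).
  (* An infinite requirement corresponds to [setT], of probability [1 = expR 0], so that the formula
     for [p] covers this case too. *)
  pose B k : set R := if Dk k v == 0 then setT else `]Wk k v * Dk k v, +oo[%classic.
  have IT : (\int[P]_w' (\prod_(k < A v t) z ^+ (Z (X3 w') k \in B k))%:E = F v)%E.
    apply: (independent_thinning P (fun w' => Z (X3 w')) B (p ^~ v) z (A v t)) => //.
    - by move=> k; exact: (ZX_exp k).1.
    - exact: ZX_indep.
    - by move=> k; rewrite /B; case: ifP => // _; exact: measurable_itv.
    - move=> k; rewrite /B /p; case: eqVneq => [->|_].
      by rewrite mulr0 oppr0 expR0 preimage_setT probability_setT.
    rewrite -(std_exponential_tail P (fun w' => Z (X3 w') k))//.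
    by congr (P _); apply/seteqP; split => w' /=; rewrite in_itv/= andbT.
  rewrite -IT; apply: eq_integral => w' _; congr EFin.
  rewrite model_countE -prodrXr; apply: eq_bigr => k _; congr (_ ^+ nat_of_bool _).
  rewrite /present /B/=; case: ifPn => [_|_]; first by rewrite in_setT.
  by apply/idP/idP; rewrite inE/= in_itv/= andbT.
have mF : measurable_fun setT F.
  apply/measurable_EFinP.
  apply: (measurable_fun_nat_index (fun v => A v t)
    (fun K v => \prod_(k < K) (1 - (1 - z) * p k v))) => [|K].
    exact: measurable_arrival_count.
  apply: measurable_prod => k _; apply: measurable_funB => //.
  apply: measurable_funM => //; apply: measurableT_comp => //.
  apply: measurableT_comp => //; apply: measurable_funM.
    exact: measurable_Wk.
  exact: measurable_Dk.
rewrite (decouple P _ _ _ _ X1 X2 F)//; last first.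
  move=> v; rewrite lee_fin; apply: prodr_ge0 => k _.
  have /andP[p0 p1] := p01 k v; rewrite subr_ge0 mulr_ile1 ?subr_ge0//.
  by rewrite gerBl.
apply: eq_integral => w _.
(* The generating function of the survival indicator of a job arriving at [s]; [lam] times [q - 1]
   is [z - 1] times the integrand of [phi]. *)
pose q s := 1 - (1 - z) * expR (- (W (X1 w) s * D (X1 w) s)).
transitivity (\int[P]_w2 (\prod_(k < A (X1 w, X2 w2) t)
    q (jump_time (A (X1 w, X2 w2)) k))%:E)%E.
  apply: eq_integral => w2 _; congr EFin; apply: eq_bigr => k _.
  by rewrite /q /p /Wk /Dk ltn_ord !mul1r.
have ca : cadlag (lam \o J (X1 w)) by exact: cadlag_comp (J_cadlag _).
have la0 s : 0 <= (lam \o J (X1 w)) s by exact: lam_ge0.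
rewrite (poisson_jump_functional P (Y \o X2) YX_poisson t (lam \o J (X1 w)) t0 ca la0 q)//.
- congr ((expR _)%:E); rewrite /phi /Defs.Rint -RintegralZr//; last first.
    by apply: (phi_integrand_integrable lam kap mu t (J (X1 w))).
  apply: eq_Rintegral => s _; rewrite /q /W /D /=.
  rewrite mulNr [in RHS](mulrC (kap _)); ring.
- move=> s u s0 sut us; apply: cvgB; first exact: cvg_cst.
  apply: cvgMr; apply: continuous_cvg; first exact: continuous_expR.
  by apply: cvgN; apply: cvgM; [exact: W_right_seq|exact: D_right_seq].
- move=> s s0; have e1 : expR (- (W (X1 w) s * D (X1 w) s)) <= 1.
    by rewrite -expR0 ler_expR oppr_le0 mulr_ge0 ?W_ge0 ?kap_ge0.
  have e0 := expR_ge0 (- (W (X1 w) s * D (X1 w) s)).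
  by rewrite /q; apply/andP; split; nra.
Qed.

End queue_model.

(** * Mixed Poisson laws *)

Section generating_functions.
Context {R : realType}.

(** Once the common terms below [j] are cancelled and [z ^+ j] is divided out, the tail of [v]
    contributes at most [z]. A small [z] then compares the leading coefficients, and no series is
    differentiated. *)
Lemma le_coeff_pow_series (u v : nat -> R) (j : nat) :
  (forall k, 0 <= u k) -> (forall k, 0 <= v k) ->
  (\sum_(k <oo) (v k)%:E <= 1)%E ->
  (forall z : R, (0 <= z <= 1)%R ->
    \sum_(k <oo) (z ^+ k * u k)%:E = \sum_(k <oo) (z ^+ k * v k)%:E)%E ->
  (forall i, (i < j)%N -> u i = v i) -> u j <= v j.
Proof.
move=> u0 v0 v1 uv uvj; apply/ler_addgt0Pr => e e0.
pose z := Num.min e 1.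
have z0 : 0 < z by rewrite lt_min e0 ltr01.
have z1 : z <= 1 by rewrite ge_min lexx orbT.
have ze : z <= e by rewrite ge_min lexx.
have zu k : 0 <= z ^+ k * u k by rewrite mulr_ge0// exprn_ge0// ltW.
have zv k : 0 <= z ^+ k * v k by rewrite mulr_ge0// exprn_ge0// ltW.
suff : z ^+ j * u j <= z ^+ j * v j + z ^+ j * z.
  rewrite -mulrDr ler_pM2l ?exprn_gt0// => /le_trans; apply.
  by rewrite lerD2l.
have := uv z; rewrite (ltW z0) z1 => /(_ isT).
rewrite (@nneseries_split _ _ 0 j.+1)//; last by move=> k _; rewrite lee_fin.
rewrite [RHS](@nneseries_split _ _ 0 j.+1)//; last by move=> k _; rewrite lee_fin.
rewrite add0n !big_nat_recr//= !sumEFin.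
set Su := \sum_(_ <- _) _; set Sv := \sum_(_ <- _) _.
have -> : Su = Sv.
  by apply: eq_big_nat => i /andP[_ ij]; rewrite uvj.
set tu := (\sum_(_ <= k <oo) (_ * u _)%:E)%E.
set tv := (\sum_(_ <= k <oo) (_ * v _)%:E)%E => E.
have tu0 : (0 <= tu)%E by apply: nneseries_ge0 => k _ _; rewrite lee_fin.
have tvz : (tv <= (z ^+ j.+1)%:E)%E.
  apply: (@le_trans _ _ (\sum_(j.+1 <= k <oo) ((z ^+ j.+1)%:E * (v k)%:E))%E).
    rewrite /tv eseries_cond [leRHS]eseries_cond.
    apply: lee_nneseries => [k _ _|k /= jk]; first by rewrite lee_fin.
    rewrite -EFinM lee_fin.
    rewrite ler_wpM2r// -(subnK jk) exprD ler_piMl ?exprn_ge0 ?(ltW z0)//.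
    by rewrite exprn_ile1// ltW.
  rewrite nneseriesZl; last by move=> k _; rewrite lee_fin.
  rewrite -[leRHS]mule1; apply: lee_wpmul2l; first by rewrite lee_fin exprn_ge0// ltW.
  apply: le_trans v1; rewrite [leRHS](@nneseries_split _ _ 0 j.+1)//.
    rewrite add0n leeDr//; apply: sume_ge0 => k _; by rewrite lee_fin.
  by move=> k _; rewrite lee_fin.
have : ((Sv + z ^+ j * u j)%:E <= (Sv + z ^+ j * v j)%:E + (z ^+ j.+1)%:E)%E.
  rewrite EFinD (le_trans (leeDl _ tu0))// E EFinD.
  by rewrite leeD2l.
by rewrite -EFinD lee_fin exprSr -addrA lerD2l.
Qed.

Lemma eq_coeff_pow_series (u v : nat -> R) :
  (forall k, 0 <= u k) -> (forall k, 0 <= v k) ->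
  (\sum_(k <oo) (u k)%:E <= 1)%E -> (\sum_(k <oo) (v k)%:E <= 1)%E ->
  (forall z : R, (0 <= z <= 1)%R ->
    \sum_(k <oo) (z ^+ k * u k)%:E = \sum_(k <oo) (z ^+ k * v k)%:E)%E ->
  u =1 v.
Proof.
move=> u0 v0 u1 v1 uv j; elim/ltn_ind: j => j IH; apply/eqP; rewrite eq_le.
apply/andP; split; apply: le_coeff_pow_series => //.
- by move=> z z01; rewrite uv.
- by move=> i ij; rewrite IH.
Qed.

Lemma measurable_poisson_pmf k : measurable_fun setT (fun r : R => Defs.poisson_pmf r k).
Proof.
apply: measurable_funM => //; apply: measurable_funM => //.
exact: measurableT_comp.
Qed.

(** Both sides of the hypothesis are power series on [[0, 1]], with coefficients the probabilities
    of [M] and the averaged Poisson weights. At [z = 1] each has total mass one, and coefficients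
    can be compared. *)
Lemma mixed_poisson_of_pgf {d : measure_display} {Omega : measurableType d}
    (P : probability Omega R) (M : Omega -> nat) (X : Omega -> R) :
  measurable_fun setT M -> measurable_fun setT X -> (forall w, 0 <= X w) ->
  (forall z : R, (0 <= z <= 1)%R ->
    \int[P]_w (z ^+ M w)%:E = \int[P]_w (expR (X w * (z - 1)))%:E)%E ->
  forall j, (P [set w | M w = j] = \int[P]_w (Defs.poisson_pmf (X w) j)%:E)%E.
Proof.
move=> mM mX X0 pgf.
have mMj j : measurable [set w | M w = j] by exact: (measurable_nat_preimage M [set j]).
have mpmf j : measurable_fun setT (fun w => Defs.poisson_pmf (X w) j).
  by apply: (@measurableT_comp _ _ _ _ _ _ (fun r => Defs.poisson_pmf r j)) => //;
    exact: measurable_poisson_pmf.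
have pmf0 w j : 0 <= Defs.poisson_pmf (X w) j by exact: poisson_pmf_ge0.
have powM z : 0 <= z <= 1 ->
    (\sum_(k <oo) (z ^+ k)%:E * P [set w | M w = k] = \int[P]_w (z ^+ M w)%:E)%E.
  move=> /andP[z0 z1].
  transitivity (\sum_(k <oo) \int[P]_w ((z ^+ k)%:E * (\1_[set w | M w = k] w)%:E))%E.
    apply: eq_eseriesr => k _; rewrite ge0_integralZl//; last 2 first.
    - by apply/measurable_EFinP.
    - by rewrite lee_fin exprn_ge0.
    by rewrite integral_indic// setIT.
  rewrite -integral_nneseries//; last 2 first.
  - by move=> k; apply: measurable_funeM; exact/measurable_EFinP.
  - by move=> k w _; rewrite mule_ge0// lee_fin ?exprn_ge0.
  apply: eq_integral => w _; rewrite (@nneseries_single _ _ (M w)).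
  - by rewrite indicE mem_set// mule1.
  - by rewrite mule_ge0// lee_fin ?exprn_ge0.
  - by move=> k kM; rewrite indicE memNset ?mule0//= => /esym/eqP; rewrite (negbTE kM).
have powX z : 0 <= z <= 1 -> (\sum_(k <oo) (z ^+ k)%:E *
    \int[P]_w (Defs.poisson_pmf (X w) k)%:E = \int[P]_w (expR (X w * (z - 1)))%:E)%E.
  move=> /andP[z0 z1].
  transitivity (\sum_(k <oo) \int[P]_w ((z ^+ k)%:E * (Defs.poisson_pmf (X w) k)%:E))%E.
    apply: eq_eseriesr => k _; rewrite ge0_integralZl//; last 3 first.
    - exact/measurable_EFinP.
    - by move=> w _; rewrite lee_fin.
    - by rewrite lee_fin exprn_ge0.
  rewrite -integral_nneseries//; last 2 first.
  - by move=> k; apply: measurable_funeM; exact/measurable_EFinP.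
  - by move=> k w _; rewrite mule_ge0// lee_fin ?exprn_ge0.
  apply: eq_integral => w _; under eq_eseriesr do rewrite -EFinM.
  exact: poisson_pmf_sum_pow.
have sumM : (\sum_(k <oo) P [set w | M w = k] = 1)%E.
  transitivity (\int[P]_w (1 ^+ M w)%:E)%E.
    rewrite -powM ?ler01 ?lexx//.
    by apply: eq_eseriesr => k _; rewrite expr1n mul1e.
  under eq_integral do rewrite expr1n.
  by rewrite integral_cst//= probability_setT mul1e.
have sumX : (\sum_(k <oo) \int[P]_w (Defs.poisson_pmf (X w) k)%:E = 1)%E.
  transitivity (\int[P]_w (expR (X w * (1 - 1)))%:E)%E.
    rewrite -powX ?ler01 ?lexx//.
    by apply: eq_eseriesr => k _; rewrite expr1n mul1e.
  under eq_integral do rewrite subrr mulr0 expR0.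
  by rewrite integral_cst//= probability_setT mul1e.
have Mfin k : P [set w | M w = k] \is a fin_num by rewrite fin_num_measure.
have X_ge0 k : (0 <= \int[P]_w (Defs.poisson_pmf (X w) k)%:E)%E.
  by apply: integral_ge0 => w _; rewrite lee_fin.
have Xfin k : (\int[P]_w (Defs.poisson_pmf (X w) k)%:E)%E \is a fin_num.
  rewrite ge0_fin_numE// (@le_lt_trans _ _ 1%E) ?ltry// -sumX.
  rewrite (@nneseriesD1 _ _ k)// leeDl//.
  by rewrite eseries_mkcond; apply: nneseries_ge0 => i _ _; case: ifP.
move=> j; rewrite -(fineK (Mfin j)) -(fineK (Xfin j)); congr EFin.
apply: (eq_coeff_pow_series (fun j => fine (P [set w | M w = j]))
  (fun j => fine (\int[P]_w (Defs.poisson_pmf (X w) j)%:E)%E)) => [k|k|||z z01].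
- by rewrite fine_ge0.
- by rewrite fine_ge0.
- by under eq_eseriesr do rewrite fineK//; rewrite sumM.
- by under eq_eseriesr do rewrite fineK//; rewrite sumX.
- under eq_eseriesr do rewrite EFinM fineK//.
  rewrite powM// pgf// -powX//.
  by apply: eq_eseriesr => k _; rewrite EFinM fineK.
Qed.
End generating_functions.

(** * Poisson estimates and the rate function *)

Section poisson_estimates.
Context {R : realType}.

(** Markov's inequality with the tilt [j0 / x], the optimal one for the level [j0]; the hypothesis
    says that [j0] bounds the tilted weight on [S] from below, on whichever side of [x] this set
    lies. For [j0 = 0] the convention [0 ^+ 0 = 1] keeps the argument valid. *)
Lemma poisson_pow_bound (x : R) (j0 : nat) (S : pred nat) : 0 < x ->
  (forall j, S j -> (j0%:R / x) ^+ j0 <= (j0%:R / x) ^+ j) ->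
  exists2 r, ell x j0%:R = r%:E &
    (\sum_(j <oo | S j) (Defs.poisson_pmf x j)%:E <= (expR (- r))%:E)%E.
Proof.
move=> x0 Sz; set z := j0%:R / x.
have z0 : 0 <= z by rewrite divr_ge0// ltW.
have [r rE zr] : exists2 r, ell x j0%:R = r%:E & expR (x * (z - 1)) = z ^+ j0 * expR (- r).
  rewrite /ell ltrn0; case: eqVneq => [j0E|j00].
    exists x => //; rewrite /z j0E mul0r.
    move/eqP : j0E; rewrite pnatr_eq0 => /eqP ->.
    by rewrite expr0 mul1r; congr expR; ring.
  exists (x - j0%:R + j0%:R * ln z); first by rewrite gt_eqF.
  have zp : 0 < z by rewrite divr_gt0// lt0r j00 ler0n.
  rewrite -{2}(lnK zp) -expRM_natl -expRD; congr expR.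
  rewrite mulrBr /z mulrCA divff ?gt_eqF// mulr_natl; ring.
have zj0 : 0 < z ^+ j0.
  rewrite /z; case: j0 {Sz z z0 rE zr} => [|j0]; first by rewrite expr0.
  by rewrite exprn_gt0// divr_gt0.
exists r => //; rewrite -(@lee_pmul2l _ (z ^+ j0)%:E)// -EFinM -zr.
rewrite -nneseriesZl; last by move=> j _; rewrite lee_fin poisson_pmf_ge0// ltW.
rewrite -poisson_pmf_sum_pow ?(ltW x0)// eseries_mkcond.
apply: lee_nneseries => j _; first by case: ifP => // _; rewrite -EFinM lee_fin mulr_ge0 ?(ltW zj0)// poisson_pmf_ge0// ltW.
case: ifP => [Sj|_]; rewrite -?EFinM lee_fin.
  by rewrite ler_wpM2r ?Sz// poisson_pmf_ge0// ltW.
by rewrite mulr_ge0 ?exprn_ge0// poisson_pmf_ge0// ltW.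
Qed.

(** The set is cut at the mean [x]: on the right its least element gives a tilt at least [1], on the
    left its greatest element gives a tilt at most [1]. Each half costs one exponential, hence the
    factor [2]. At [x = 0] all mass sits at [0]. *)
Lemma poisson_chernoff (x c : R) (S : pred nat) : 0 <= x ->
  (forall j, S j -> (c%:E <= ell x j%:R)%E) ->
  (\sum_(j <oo | S j) (Defs.poisson_pmf x j)%:E <= (2 * expR (- c))%:E)%E.
Proof.
rewrite le_eqVlt => /predU1P[<-|x0] cS.
  apply: (@le_trans _ _ ((S 0%N)%:R)%:E).
    rewrite eseries_mkcond (@nneseries_single _ _ 0%N).
    - by case: ifP => // _; rewrite /Defs.poisson_pmf oppr0 expR0 expr0 mulr1 fact0 divr1.
    - by case: ifP => // _; rewrite lee_fin poisson_pmf_ge0.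
    - move=> [//|k] _; case: ifP => // _.
      by rewrite /Defs.poisson_pmf expr0n mulr0 mul0r.
  rewrite lee_fin; case S0 : (S 0%N); last by rewrite mulr_ge0// expR_ge0.
  have := cS _ S0; rewrite /ell ltxx eqxx lee_fin => c0.
  have : 1 <= expR (- c) by rewrite -expR0 ler_expR oppr_ge0.
  by move=> ?; rewrite /=; lra.
have pmf0 j : (0 <= (Defs.poisson_pmf x j)%:E)%E.
  by rewrite lee_fin poisson_pmf_ge0// ltW.
have half (T : pred nat) : (forall j, T j -> S j) ->
    ((exists j, T j) -> exists2 j0, T j0 &
      forall j, T j -> (j0%:R / x) ^+ j0 <= (j0%:R / x) ^+ j) ->
    (\sum_(j <oo | T j) (Defs.poisson_pmf x j)%:E <= (expR (- c))%:E)%E.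
  move=> TS Tz; have [/Tz [j0 Tj0 Tj]|T0] := pselect (exists j, T j).
    have [r rE] := poisson_pow_bound x j0 T x0 Tj.
    move=> /le_trans; apply; rewrite lee_fin ler_expR lerN2 -lee_fin -rE.
    by apply/cS/TS.
  rewrite eseries0 ?lee_fin ?expR_ge0// => i _ Ti.
  by exfalso; apply: T0; exists i.
rewrite (_ : \sum_(j <oo | S j) _ = \sum_(j <oo | S j && (x <= j%:R)%R) (Defs.poisson_pmf x j)%:E +
   \sum_(j <oo | S j && (j%:R < x)%R) (Defs.poisson_pmf x j)%:E)%E; last first.
  rewrite [LHS]eseries_mkcond [X in _ = (X + _)%E]eseries_mkcond.
  rewrite [X in _ = (_ + X)%E]eseries_mkcond -nneseriesD.
  - by apply: eq_eseriesr => j _; case: (S j) => /=; case: (leP x j%:R); rewrite ?adde0 ?add0e.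
  - by move=> j _ _; case: ifP.
  - by move=> j _ _; case: ifP.
rewrite mulr_natl mulr2n EFinD; apply: leeD.
- apply: half => [j /andP[]//|ex].
  case: (ex_minnP ex) => j0 /andP[Sj0 xj0] j0min.
  exists j0; first by rewrite Sj0.
  move=> j Tj; rewrite ler_weXn2l ?j0min//.
  by rewrite ler_pdivlMr// mul1r.
- apply: half => [j /andP[]//|ex].
  have bnd j : S j && (j%:R < x) -> (j <= Num.truncn x)%N.
    by move=> /andP[_ /ltW jx]; rewrite truncn_ge_nat// ltW.
  case: (ex_maxnP ex bnd) => j0 /andP[Sj0 xj0] j0max.
  exists j0; first by rewrite Sj0.
  move=> j Tj; rewrite ler_wiXn2l ?j0max//.
    by rewrite divr_ge0// ltW.
  by rewrite ler_pdivrMr// mul1r ltW.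
Qed.

Lemma fact_le_stirling (j : nat) : (0 < j)%N ->
  (j`!%:R : R) <= expR 1 * j%:R * expR (j%:R * ln j%:R - j%:R).
Proof.
case: j => // j _; elim: j => [|j IH].
  by rewrite mulr1 ln1 mulr0 sub0r -expRD subrr expR0.
rewrite factS natrM.
have j1 : 0 < j.+1%:R :> R by [].
have j2 : 0 < j.+2%:R :> R by [].
apply: (@le_trans _ _ (j.+2%:R * (expR 1 * j.+1%:R * expR (j.+1%:R * ln j.+1%:R - j.+1%:R)))).
  by rewrite ler_wpM2l.
set X := expR (_ - _) in IH *; set X' := expR (_ - _).
(* In logarithms this is [ln u <= u - 1] at [u = j.+1 / j.+2], multiplied by [j.+2]. *)
suff key : j.+1%:R * X <= X'.
  rewrite (_ : j.+2%:R * _ = expR 1 * j.+2%:R * (j.+1%:R * X)); last by ring.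
  by rewrite ler_wpM2l// mulr_ge0 ?expR_ge0.
rewrite -{1}(lnK (j1 : j.+1%:R \is Num.pos)) -expRD ler_expR.
have lnj : ln (j.+1%:R / j.+2%:R) <= j.+1%:R / j.+2%:R - 1 :> R.
  have := @le_ln1Dx R (j.+1%:R / j.+2%:R - 1).
  rewrite subrKC; apply.
  by rewrite ltrBrDl subrr divr_gt0.
rewrite ln_div// in lnj.
have : j.+2%:R * (ln j.+1%:R - ln j.+2%:R) <= j.+1%:R - j.+2%:R :> R.
  apply: (le_trans (ler_wpM2l (ltW j2) lnj)).
  by rewrite mulrBr mulr1 mulrCA divff ?gt_eqF// mulr1.
have -> : j.+2%:R = j.+1%:R + 1 :> R by rewrite -natr1.
nra.
Qed.

(** The exponent on the left is minus the value of [ell y] at [j], so the Chernoff rate is sharp up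
    to the prefactor [expR 1 * j], invisible on the exponential scale. *)
Lemma poisson_pmf_ge (y : R) (j : nat) : 0 < y -> (0 < j)%N ->
  expR (- (y - j%:R + j%:R * ln (j%:R / y))) <= expR 1 * j%:R * Defs.poisson_pmf y j.
Proof.
move=> y0 j0; have jp : 0 < j%:R :> R by rewrite ltr0n.
have fp : 0 < j`!%:R :> R by rewrite ltr0n fact_gt0.
rewrite /Defs.poisson_pmf mulrA ler_pdivlMr//.
have := fact_le_stirling j j0.
have e1 : 0 <= expR (- (y - j%:R + j%:R * ln (j%:R / y))) by exact: expR_ge0.
move=> /(ler_wpM2l e1) /le_trans; apply.
set X := expR _; set X' := expR (j%:R * _ - _).
have yj : y ^+ j = expR (j%:R * ln y) by rewrite expRM_natl lnK.
have XX : X * X' = expR (- y) * y ^+ j.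
  by rewrite yj -!expRD; congr expR; rewrite ln_div//; ring.
rewrite (_ : X * _ = expR 1 * j%:R * (X * X')); last by ring.
by rewrite XX !mulrA.
Qed.

(** Young's inequality, from [ln u <= u - 1] at [u = g * expR th / a]. With the next lemma it
    exhibits [ell] as a supremum of functions linear in [(g, a)], the form in which its
    semicontinuity and growth are used. *)
Lemma ell_dual_le (g a th : R) : 0 <= g ->
  ((th * a - g * (expR th - 1))%:E <= ell g a)%E.
Proof.
move=> g0; rewrite /ell; case: (ltP a 0) => [_|a0]; first by rewrite leey.
case: eqVneq => [->|an0].
  rewrite lee_fin mulr0 sub0r mulrBr mulr1 opprB lerBlDr lerDl.
  by rewrite mulr_ge0// expR_ge0.
case: eqVneq => [_|gn0]; first by rewrite leey.
have gp : 0 < g by rewrite lt0r gn0.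
have ap : 0 < a by rewrite lt0r an0.
rewrite lee_fin.
have u0 : 0 < g * expR th / a by rewrite divr_gt0// mulr_gt0// expR_gt0.
have := @le_ln1Dx R (g * expR th / a - 1).
rewrite subrKC ltrBrDl subrr => /(_ u0).
rewrite ln_div ?posrE ?mulr_gt0 ?expR_gt0// lnM ?posrE ?expR_gt0// expRK => H.
have := ler_wpM2l (ltW ap) H.
rewrite [in X in _ <= X]mulrBr mulrCA divff ?gt_eqF// !mulr1 ln_div ?posrE//; lra.
Qed.

Lemma ell_dual_approx (g a c : R) : 0 <= g -> (c%:E < ell g a)%E ->
  exists th, c < th * a - g * (expR th - 1).
Proof.
move=> g0; rewrite /ell; case: (ltP a 0) => [a0 _|a0].
  (* This negative slope makes [th * a] equal to |c| + 1, while [expR th <= 1] keeps the other term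
     nonnegative. *)
  exists ((`|c| + 1) / a); rewrite divfK ?lt_eqF//.
  have : expR ((`|c| + 1) / a) <= 1.
    rewrite -expR0 ler_expR; apply: mulr_ge0_le0; first by rewrite addr_ge0.
    by rewrite invr_le0 (ltW a0).
  have := ler_norm c; nra.
case: eqVneq => [-> |an0].
  rewrite lte_fin => cg.
  have [g0'|gp] := eqVneq g 0; first by exists 0; rewrite !mul0r sub0r expR0 subrr mulr0 oppr0 -g0'.
  have gp' : 0 < g by rewrite lt0r gp.
  have e0 : 0 < (g - c) / (2 * g) by rewrite divr_gt0 ?subr_gt0// mulr_gt0.
  (* The supremum [g] is only approached as [th] tends to minus infinity; this choice attains the
     midpoint [(g + c) / 2]. *)
  exists (ln ((g - c) / (2 * g))); rewrite lnK ?posrE// mulr0 sub0r mulrBr mulr1.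
  rewrite (_ : g * ((g - c) / (2 * g)) = (g - c) / 2); first lra.
  by field.
have ap : 0 < a by rewrite lt0r an0.
case: eqVneq => [-> _|gn0].
  exists ((`|c| + 1) / a); rewrite divfK ?gt_eqF// mul0r subr0.
  by have := ler_norm c; lra.
have gp : 0 < g by rewrite lt0r gn0.
rewrite lte_fin => H; exists (ln (a / g)); rewrite lnK ?posrE ?divr_gt0//.
rewrite mulrBr mulr1 mulrCA divff// mulr1; lra.
Qed.

End poisson_estimates.

(** * Exponential bounds and the large deviations principle *)

Section limsup_bounds.
Context {R : realType}.
Local Open Scope ereal_scope.
Implicit Types (u : nat -> \bar R) (L : \bar R).

Lemma lte_real_between (x y : \bar R) : x < y -> exists2 r, x < r%:E & r%:E < y.
Proof.
case: x y => [x| |] [y| |]// xy.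
- exists ((x + y) / 2)%R; rewrite lte_fin in xy; rewrite lte_fin; lra.
- by exists (x + 1)%R; rewrite ?ltry// lte_fin; lra.
- by exists (y - 1)%R; rewrite ?ltNyr// lte_fin; lra.
- by exists 0%R; rewrite ?ltNyr ?ltry.
Qed.

Lemma limn_esup_le u L :
  (forall r, L < r%:E -> \forall n \near \oo, u n <= r%:E) -> limn_esup u <= L.
Proof.
move=> uL; rewrite leNgt; apply/negP => /lte_real_between[r Lr].
apply/negP; rewrite -leNgt; have [N _ NV] := uL r Lr.
apply: (@le_trans _ _ (ereal_sup (u @` [set n | (N <= n)%N]))).
  by apply: ereal_inf_lbound; exists [set n | (N <= n)%N] => //; exists N.
by apply: ge_ereal_sup => _ [n /NV un <-].
Qed.

Lemma limn_esup_lt u r : limn_esup u < r%:E -> \forall n \near \oo, u n <= r%:E.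
Proof.
move=> /ereal_inf_lt [_ [V [N _ NV] <-] ur]; exists N => // n /NV Vn.
by apply: le_trans (ltW ur); apply: ereal_sup_ubound; exists n.
Qed.

Lemma le_limn_einf u L :
  (forall r, r%:E < L -> \forall n \near \oo, r%:E <= u n) -> L <= limn_einf u.
Proof.
move=> uL; rewrite /limn_einf leeNr; apply: limn_esup_le => r.
rewrite lteNl -EFinN => /uL [N _ NV]; exists N => // n /NV.
by rewrite /= EFinN leeNl.
Qed.

Lemma lt_limn_einf u r : r%:E < limn_einf u -> \forall n \near \oo, r%:E <= u n.
Proof.
rewrite /limn_einf lteNr -EFinN => /limn_esup_lt [N _ NV]; exists N => // n /NV.
by rewrite /= EFinN leeN2.
Qed.

Lemma scaled_elog_le (n : nat) (q r : R) : (0 < n)%N -> (0 <= q)%R ->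
  ((n%:R^-1)%:E * elog q%:E <= r%:E) = (q <= expR (n%:R * r))%R.
Proof.
move=> n0 q0; have np : (0 < n%:R :> R)%R by rewrite ltr0n.
rewrite /elog; case: eqVneq => [->|qn0].
  by rewrite gt0_muleNy ?lte_fin ?invr_gt0// leNye expR_ge0.
have qp : (0 < q)%R by rewrite lt0r qn0.
by rewrite -EFinM lee_fin ler_pdivrMl// -[LHS]ler_expR lnK.
Qed.

Lemma scaled_elog_ge (n : nat) (q r : R) : (0 < n)%N -> (0 <= q)%R ->
  (r%:E <= (n%:R^-1)%:E * elog q%:E) = (expR (n%:R * r) <= q)%R.
Proof.
move=> n0 q0; have np : (0 < n%:R :> R)%R by rewrite ltr0n.
rewrite /elog; case: eqVneq => [->|qn0].
  by rewrite gt0_muleNy ?lte_fin ?invr_gt0// leeNy_eq/= leNgt expR_gt0.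
have qp : (0 < q)%R by rewrite lt0r qn0.
rewrite -EFinM lee_fin ler_pdivlMl// -[RHS]ler_ln ?posrE ?expR_gt0//.
by rewrite expRK.
Qed.

(** This lemma and the next three translate the principle, assumed or to be proved, into eventual
    inequalities between probabilities and real exponentials. The bound [maxn N 1] discards the
    index [0], where [n%:R^-1] is [0]. *)
Lemma LDP_upper_intro (q : nat -> \bar R) (S : set (\bar R)) :
  (forall n, q n \is a fin_num) -> (forall n, 0 <= q n) ->
  (forall s, s%:E < ereal_inf S ->
    \forall n \near \oo, q n <= (expR (- (n%:R * s)))%:E) ->
  limn_esup (fun n => (n%:R^-1)%:E * elog (q n)) <= - ereal_inf S.
Proof.
move=> qfin q0 H; apply: limn_esup_le => r; rewrite lteNl -EFinN => /H [N _ NV].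
exists (maxn N 1) => // n /=; rewrite geq_max => /andP[/NV + n0].
rewrite -{1 2}(fineK (qfin n)) scaled_elog_le ?fine_ge0//.
by rewrite mulrN opprK lee_fin.
Qed.

Lemma LDP_lower_intro (q : nat -> \bar R) (S : set (\bar R)) :
  (forall n, q n \is a fin_num) -> (forall n, 0 <= q n) ->
  (forall y s, S y -> y < s%:E ->
    \forall n \near \oo, (expR (- (n%:R * s)))%:E <= q n) ->
  - ereal_inf S <= limn_einf (fun n => (n%:R^-1)%:E * elog (q n)).
Proof.
move=> qfin q0 H; apply: le_limn_einf => r; rewrite lteNr -EFinN.
move=> /ereal_inf_lt [y Sy /(H y _ Sy) [N _ NV]].
exists (maxn N 1) => // n /=; rewrite geq_max => /andP[/NV + n0].
rewrite -{1 2}(fineK (qfin n)) scaled_elog_ge ?fine_ge0//.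
by rewrite mulrN opprK lee_fin.
Qed.

Lemma LDP_upper_elim (q : nat -> \bar R) (S : set (\bar R)) (s : R) :
  (forall n, q n \is a fin_num) -> (forall n, 0 <= q n) ->
  limn_esup (fun n => (n%:R^-1)%:E * elog (q n)) <= - ereal_inf S ->
  s%:E < ereal_inf S ->
  \forall n \near \oo, q n <= (expR (- (n%:R * s)))%:E.
Proof.
move=> qfin q0 H sS; have /limn_esup_lt[N _ NV] :
    limn_esup (fun n => (n%:R^-1)%:E * elog (q n)) < (- s)%:E.
  by apply: le_lt_trans H _; rewrite EFinN lteN2.
exists (maxn N 1) => // n /=; rewrite geq_max => /andP[/NV + n0].
rewrite -(fineK (qfin n)) scaled_elog_le ?fine_ge0//.
by rewrite mulrN lee_fin.
Qed.

Lemma LDP_lower_elim (q : nat -> \bar R) (S : set (\bar R)) (y : \bar R) (s : R) :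
  (forall n, q n \is a fin_num) -> (forall n, 0 <= q n) ->
  - ereal_inf S <= limn_einf (fun n => (n%:R^-1)%:E * elog (q n)) ->
  S y -> y < s%:E ->
  \forall n \near \oo, (expR (- (n%:R * s)))%:E <= q n.
Proof.
move=> qfin q0 H Sy ys; have /lt_limn_einf[N _ NV] :
    (- s)%:E < limn_einf (fun n => (n%:R^-1)%:E * elog (q n)).
  apply: lt_le_trans H; rewrite EFinN lteN2.
  by apply: le_lt_trans ys; exact: ereal_inf_lbound.
exists (maxn N 1) => // n /=; rewrite geq_max => /andP[/NV + n0].
rewrite -(fineK (qfin n)) scaled_elog_ge ?fine_ge0//.
by rewrite mulrN lee_fin.
Qed.
End limsup_bounds.

(** * Semicontinuity and growth of [ell] and of the rate function *)

Section ell_regularity.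
Context {R : realType}.
Implicit Types g a c : R.

Lemma ell_ge0 g a : 0 <= g -> (0 <= ell g a)%E.
Proof.
by move=> g0; have := ell_dual_le g a 0 g0; rewrite mul0r expR0 subrr mulr0 subr0.
Qed.

(** Homogeneity turns the cost of the value [j] under the mean [n * x] into [n] times the cost of
    [j / n] under [x]. *)
Lemma ell_scale (k g a : R) : 0 < k -> 0 <= g -> ell (k * g) (k * a) = (k%:E * ell g a)%E.
Proof.
move=> k0 g0; rewrite /ell pmulr_rlt0// !mulf_eq0 gt_eqF//=.
case: (ltP a 0) => [_|a0]; first by rewrite gt0_muley// lte_fin.
case: (eqVneq a 0) => [_|_]; first by rewrite EFinM.
case: (eqVneq g 0) => [_|gn0]; first by rewrite gt0_muley// lte_fin.
rewrite -EFinM; congr EFin; rewrite -mulf_div divff ?gt_eqF// mul1r; ring.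
Qed.

(** A linear minorant of [ell] exceeding [c] by [w] at [(g, a)] loses less than [w] on the box,
    since its two slopes are [th] and [- v]; the added [1] keeps the denominator positive. *)
Lemma ell_lsc g a c : 0 <= g -> (c%:E < ell g a)%E ->
  exists2 e, 0 < e & forall g' a', `|g - g'| < e -> `|a - a'| < e -> 0 <= g' ->
    (c%:E < ell g' a')%E.
Proof.
move=> g0 /(ell_dual_approx _ _ _ g0)[th cth].
set v := expR th - 1; pose w := th * a - g * v - c.
have w0 : 0 < w by rewrite subr_gt0.
have den : 0 < `|th| + `|v| + 1 by rewrite ltr_wpDl// addr_ge0.
exists (w / (`|th| + `|v| + 1)); first by rewrite divr_gt0.
move=> g' a'; rewrite !ltr_pdivlMr// => gg' aa' g'0.
apply: lt_le_trans (ell_dual_le g' a' th g'0); rewrite lte_fin -/v.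
have Ha : th * (a - a') <= `|a - a'| * `|th|.
  by rewrite mulrC -normrM; exact: ler_norm.
have Hg : (g' - g) * v <= `|g - g'| * `|v|.
  by rewrite distrC -normrM; exact: ler_norm.
have := normr_ge0 (a - a'); have := normr_ge0 (g - g').
have := normr_ge0 th; have := normr_ge0 v.
move: Ha Hg gg' aa'; rewrite /w; move: `|a - a'| `|g - g'| `|th| `|v| => p q r s.
move=> Ha Hg Hq Hp s0 r0 q0 p0.
have [pq|qp] := leP p q; nra.
Qed.

(** As [F] may be unbounded, large [a] must be controlled. The slope [1] gives
    [ell g' a >= a - g' * (expR 1 - 1)], which exceeds [c] beyond [B] for all [g' < g + 1]; on
    [[0, B]] compactness and joint semicontinuity suffice. *)
Lemma closed_ell_sublevel (F : set R) c : closed F ->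
  closed [set g | 0 <= g /\ exists2 a, F a & (ell g a <= c%:E)%E].
Proof.
move=> cF; rewrite -[X in closed X]setCK; apply: open_closedC.
rewrite openE => g /= gC; rewrite /interior/=.
have [g_lt0|g0] := ltP g 0.
  have : \forall g' \near g, g' < 0 by exact: lt_nbhsl.
  by apply: filterS => g' g'0 [] /(lt_le_trans g'0); rewrite ltxx.
have Fc a : F a -> (c%:E < ell g a)%E.
  by move=> Fa; rewrite ltNge; apply/negP => ac; apply: gC; split => //; exists a.
pose B := `|c| + (g + 1) * (expR 1 - 1) + 1.
have cpt : compact (F `&` `[0, B]).
  by rewrite setIC; apply: compact_closedI => //; exact: segment_compact.
have cov : \forall g' \near g,
    (F `&` `[0, B]) `<=` (fun a => 0 <= g' -> (c%:E < ell g' a)%E).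
  apply: ((iffLR (compact_near_coveringP _) cpt) R (nbhs g)
    (fun g' a => 0 <= g' -> (c%:E < ell g' a)%E)) => a [Fa _].
  have [e e0 He] := ell_lsc g a c g0 (Fc a Fa).
  exists (ball a e, ball g e); first by split; exact: nbhsx_ballx.
  by move=> [a' g'] [/= aa' gg'] g'0; exact: He.
have g1 : \forall g' \near g, g' < g + 1 by apply: lt_nbhsl; rewrite ltrDl.
near=> g' => -[g'0 [a Fa]]; apply/negP; rewrite -ltNge.
have [aB|Ba] := leP a B; last first.
  apply: lt_le_trans (ell_dual_le g' a 1 g'0); rewrite lte_fin mul1r.
  have e1 : 0 <= expR 1 - 1 :> R by rewrite subr_ge0 -expR0 ler_expR.
  have g'1 : g' < g + 1 by near: g'.
  have := ler_norm c; move: Ba; rewrite /B => Ba.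
  have := ler_wpM2r e1 (ltW g'1); lra.
have [a0|a0] := ltP a 0; first by rewrite /ell a0 ltry.
have covg : (F `&` `[0, B]) `<=` (fun a => 0 <= g' -> (c%:E < ell g' a)%E) by near: g'.
by apply: covg => //; split => //=; rewrite in_itv/= a0 aB.
Unshelve. all: by end_near. Qed.

Lemma lteD_split (x y : \bar R) c : (0 <= x)%E -> (0 <= y)%E -> (c%:E < x + y)%E ->
  exists e p, [/\ (e%:E < x)%E, (p%:E < y)%E & c <= e + p].
Proof.
case: x y => [x| |] [y| |]//; rewrite ?lee_fin => x0 y0 cxy.
- exists (x - (x + y - c) / 2), (y - (x + y - c) / 2).
  by rewrite -EFinD lte_fin in cxy; rewrite !lte_fin; split; lra.
- by exists (x - 1), (c - x + 1); rewrite ltry lte_fin; split => //; lra.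
- by exists (c - y + 1), (y - 1); rewrite ltry lte_fin; split => //; lra.
- by exists c, 0; rewrite !ltry; split => //; lra.
Qed.

(** Here large [g] must be controlled without any growth of [psi]: the slope [- 1] gives
    [ell g y >= k * g - y] with [k = 1 - expR (- 1)], so [ell] alone suffices beyond [B]. As [psi]
    is [+oo] off [S], the compactness argument can run over all of [[0, B]]. *)
Lemma lower_semicontinuous_inf_ell (psi : R -> \bar R) (S : set R) :
  (forall x, 0 <= psi x)%E -> lower_semicontinuous psi ->
  (forall g, S g -> 0 <= g) -> (forall g, 0 <= g -> ~ S g -> psi g = +oo%E) ->
  lower_semicontinuous (fun a => ereal_inf [set (ell g a + psi g)%E | g in S]).
Proof.
move=> psi0 psi_lsc S0 psiS x c /= /lte_real_between[c'].
rewrite lte_fin => cc' cx.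
have gx g : 0 <= g -> (c'%:E < ell g x + psi g)%E.
  move=> g0; have [Sg|Sg] := pselect (S g).
    by apply: lt_le_trans cx _; apply: ereal_inf_lbound; exists g.
  by rewrite psiS// addey ?ltry// gt_eqF// (lt_le_trans _ (ell_ge0 _ _ g0))// ltNyr.
pose k : R := 1 - expR (- 1).
have k0 : 0 < k by rewrite subr_gt0 -expR0 ltr_expR oppr_lt0.
pose B := (`|c'| + `|x| + 2) / k.
have cov : \forall y \near x,
    `[0, B] `<=` (fun g => 0 <= g -> (c'%:E < ell g y + psi g)%E).
  apply: ((iffLR (compact_near_coveringP _) (@segment_compact R 0 B)) R (nbhs x)
    (fun y g => 0 <= g -> (c'%:E < ell g y + psi g)%E)) => g.
  rewrite /= in_itv/= => /andP[g0 _].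
  have [e [p [ee pp cep]]] := lteD_split _ _ _ (ell_ge0 g x g0) (psi0 g) (gx g g0).
  have [d d0 Hd] := ell_lsc g x e g0 ee.
  have [V gV HV] := psi_lsc g p pp.
  exists (ball g d `&` V, ball x d).
    by split; [apply: filterI => //; exact: nbhsx_ballx|exact: nbhsx_ballx].
  move=> [g' y] [/= [gg' Vg'] xy] g'0; apply: (@le_lt_trans _ _ (e%:E + p%:E)%E).
    by rewrite -EFinD lee_fin.
  by apply: lteD; [exact: Hd|exact: HV].
have x1 : \forall y \near x, y < x + 1 by apply: lt_nbhsl; rewrite ltrDl.
exists [set y | y < x + 1 /\ `[0, B] `<=` (fun g => 0 <= g -> (c'%:E < ell g y + psi g)%E)].
  by apply: filterI.
move=> y [yx1 covy]; apply: (@lt_le_trans _ _ c'%:E); first by rewrite lte_fin.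
apply: le_ereal_inf_tmp => _ [g Sg <-]; apply: ltW; have g0 := S0 g Sg.
have [gB|Bg] := leP g B; first by apply: covy => //=; rewrite in_itv/= g0 gB.
apply: (@lt_le_trans _ _ (ell g y)); last by rewrite leeDl.
apply: lt_le_trans (ell_dual_le g y (- 1) g0); rewrite lte_fin.
move: Bg; rewrite /B ltr_pdivrMr// /k => Bg.
have := ler_norm c'; have := ler_norm x; lra.
Unshelve. all: by end_near. Qed.

End ell_regularity.

Section poisson_pmf_lower_bound.
Context {R : realType}.
Implicit Types g a e x : R.

Lemma cvg_truncn_ratio a : 0 <= a ->
  (Num.truncn (n%:R * a))%:R / n%:R @[n --> \oo] --> a.
Proof.
move=> a0; set u := (fun n : nat => _); rewrite -(cvg_shiftS u) /u /=.
apply: (@squeeze_cvgr _ _ _ _ (fun n => a - n.+1%:R^-1) (fun=> a)).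
- near=> n; have n0 : 0 < n.+1%:R :> R by [].
  rewrite ler_pdivlMr// ler_pdivrMr// mulrBl mulVf ?gt_eqF// (mulrC a).
  rewrite truncn_le mulr_ge0// andbT lerBlDr natr1.
  by apply/ltW; exact: truncnS_gt.
- rewrite -[X in _ --> X]subr0; apply: cvgB; first exact: cvg_cst.
  exact: cvg_harmonic.
- exact: cvg_cst.
Unshelve. all: by end_near. Qed.

(** Uniformity in [x] near [g] is needed because the bound is integrated over the random parameter.
    For [a > 0] the error [eta] is spent in quarters: on rounding [a] to [b n], on the linear term
    in [x], on the logarithm of [x], and on the prefactor [expR 1 * j]. *)
Lemma poisson_pmf_lower_bound g a e eta : 0 <= g -> ell g a = e%:E -> 0 < eta ->
  exists2 eps, 0 < eps & \forall n \near \oo, forall x, 0 <= x ->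
    g - eps < x < g + eps ->
    expR (- (n%:R * (e + eta))) <= Defs.poisson_pmf (n%:R * x) (Num.truncn (n%:R * a)).
Proof.
move=> g0; rewrite /ell; case: (ltP a 0) => // a0.
case: (eqVneq a 0) => [->|an0].
  move=> [ge] eta0; exists eta => //; apply: nearW => n x x0 /andP[_ xg].
  rewrite mulr0 truncn0 /Defs.poisson_pmf expr0 mulr1 fact0 divr1 ler_expR lerN2.
  by rewrite ler_wpM2l// -ge ltW.
case: (eqVneq g 0) => // gn0 [eE] eta0.
have ap : 0 < a by rewrite lt0r an0.
have gp : 0 < g by rewrite lt0r gn0.
(* The first entry bounds the linear term; the second keeps [x] above [g / 2], where [ln] has slope
   at most [2 / g]; the third makes [a * (2 * eps / g)] at most [eta / 4]. *)
pose eps := Num.min (eta / 4) (Num.min (g / 2) (eta * g / (8 * a))).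
have eps0 : 0 < eps by rewrite !lt_min !divr_gt0 ?mulr_gt0.
have [eps1 eps2 eps3] : [/\ eps <= eta / 4, eps <= g / 2 & eps <= eta * g / (8 * a)].
  by split; rewrite /eps !ge_min lexx ?orbT.
exists eps => //.
pose b n : R := (Num.truncn (n%:R * a))%:R / n%:R.
have ba : b n @[n --> \oo] --> a by exact: cvg_truncn_ratio.
have gb : g - b n + b n * ln (b n / g) @[n --> \oo] --> e.
  rewrite -eE; apply: cvgD; first by apply: cvgB => //; exact: cvg_cst.
  have bga : b n / g @[n --> \oo] --> a / g by exact: cvgMl.
  have lnag : {for a / g, continuous (@ln R)} by apply: continuous_ln; rewrite divr_gt0.
  by apply: cvgM => //; exact: (cvg_comp _ _ bga lnag).
have [N1 _ HN1] : \forall n \near \oo, g - b n + b n * ln (b n / g) < e + eta / 4.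
  by apply: (cvgr_lt _ gb); rewrite ltrDl divr_gt0.
have [N2 _ HN2] : \forall n \near \oo, 0 < b n by exact: (cvgr_gt _ ba).
(* Chosen so that [expR 1 * (n * a)] is at most half the square of [n * (eta / 4)], hence at most
   [expR (n * (eta / 4))]. *)
have [N3 _ HN3] : \forall n \near \oo, 32 * expR 1 * a / eta ^+ 2 <= n%:R.
  exact: nbhs_infty_ger.
exists (maxn 1 (maxn N1 (maxn N2 N3))) => // n /=; rewrite !geq_max.
move=> /and4P[n0 /HN1 /= gbn /HN2 /= bn0 /HN3 /= n3] x x0 /andP[gx xg].
have np : 0 < n%:R :> R by rewrite ltr0n.
set j := Num.truncn (n%:R * a).
have bj : b n = j%:R / n%:R by [].
move: (b n) bj gbn bn0 => bn bj gbn bn0.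
have jp : (0 < j)%N by move: bn0; rewrite bj pmulr_lgt0 ?invr_gt0// ltr0n.
have jpR : 0 < j%:R :> R by rewrite ltr0n.
have jna : j%:R <= n%:R * a by rewrite /j truncn_le mulr_ge0.
have b_le : bn <= a by rewrite bj ler_pdivrMr// mulrC.
have xp : 0 < x by lra.
have lnx : - ln x <= - ln g + 2 * eps / g.
  have : ln (g / x) <= g / x - 1.
    have := @le_ln1Dx R (g / x - 1); rewrite subrKC; apply.
    by rewrite ltrBrDl subrr divr_gt0.
  rewrite ln_div ?posrE// => H.
  have : g / x - 1 <= 2 * eps / g.
    rewrite lerBlDr ler_pdivrMr// mulrDl mul1r mulrAC -mulrA -lerBlDr.
    have : 1 <= 2 * (x / g).
      by rewrite mulrA ler_pdivlMr// mul1r; lra.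
    by rewrite mulrCA; nra.
  lra.
have key : n%:R * x - j%:R + j%:R * ln (j%:R / (n%:R * x)) <= n%:R * (e + 3 / 4 * eta).
  have -> : n%:R * x - j%:R + j%:R * ln (j%:R / (n%:R * x)) =
      n%:R * (x - bn + bn * (ln (bn) + - ln x)).
    have jE : j%:R = n%:R * bn by rewrite bj mulrC divfK ?gt_eqF.
    have -> : j%:R / (n%:R * x) = bn / x by rewrite bj invfM mulrA.
    by rewrite ln_div ?posrE// jE; ring.
  rewrite ler_pM2l//.
  have : bn * - ln x <= bn * (- ln g) + a * (2 * eps / g).
    apply: (@le_trans _ _ (bn * (- ln g + 2 * eps / g))).
      by rewrite ler_wpM2l// ltW.
    have eg0 : 0 <= 2 * eps / g by apply: divr_ge0; [apply: mulr_ge0 => //; exact: ltW|exact: ltW].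
    by rewrite mulrDr lerD2l ler_wpM2r.
  have : a * (2 * eps / g) <= eta / 4.
    rewrite mulrA ler_pdivrMr//.
    move: eps3; rewrite ler_pdivlMr ?mulr_gt0//; lra.
  move: gbn; rewrite ln_div ?posrE//; rewrite mulrBr mulrDr; lra.
have ej : expR 1 * j%:R <= expR (n%:R * (eta / 4)).
  apply: le_trans (expR_ge1Dxn 1 _); last by rewrite mulr_ge0 ?divr_ge0 ?ltW.
  apply: (@le_trans _ _ (expR 1 * (n%:R * a))); first by rewrite ler_wpM2l ?expR_ge0.
  apply: (@le_trans _ _ ((n%:R * (eta / 4)) ^+ 2 / 2)); last by rewrite lerDr.
  move: n3; rewrite ler_pdivrMr ?exprn_gt0// => n3.
  rewrite (_ : _ ^+ 2 / 2 = n%:R * (n%:R * eta ^+ 2) / 32); last by field.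
  rewrite ler_pdivlMr// -!mulrA [expR 1 * _]mulrCA ler_pM2l//.
  by apply: le_trans n3; rewrite mulrA mulrC mulrA.
have := poisson_pmf_ge (n%:R * x) j (mulr_gt0 np xp) jp => H.
have pmf0 : 0 <= Defs.poisson_pmf (n%:R * x) j by rewrite poisson_pmf_ge0// mulr_ge0.
suff : expR (n%:R * (eta / 4)) * expR (- (n%:R * (e + eta))) <=
    expR (n%:R * (eta / 4)) * Defs.poisson_pmf (n%:R * x) j.
  by rewrite ler_pM2l ?expR_gt0.
rewrite -expRD.
apply: (@le_trans _ _ (expR (- (n%:R * x - j%:R + j%:R * ln (j%:R / (n%:R * x)))))).
  rewrite ler_expR (_ : _ + _ = - (n%:R * (e + 3 / 4 * eta))); last by field.
  by rewrite lerN2.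
by apply: le_trans H _; rewrite ler_wpM2r.
Qed.

End poisson_pmf_lower_bound.

(** * Large deviations of Poisson counts with a random parameter *)

Section mixed_poisson_LDP.
Context {R : realType}.
Variables (d : nat -> measure_display) (Omega : forall n, measurableType (d n))
  (P : forall n, probability (Omega n) R).
Variables (X : forall n, Omega n -> R) (M : forall n, Omega n -> nat).
Hypotheses (mX : forall n, measurable_fun setT (X n))
  (mM : forall n, measurable_fun setT (M n)) (X0 : forall n w, 0 <= X n w).
Hypothesis mixed : forall n j, (P n [set w | M n w = j] =
  \int[P n]_w (Defs.poisson_pmf (n%:R * X n w) j)%:E)%E.
Variable psi : R -> \bar R.
Hypothesis hLDP : LDP (fun n (A : set R) => P n [set w | A (X n w)]) psi.

Let Rt : set R := [set gamma : R | 0 <= gamma /\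
  forall eps : R, 0 < eps -> exists N : nat, forall n : nat, (N <= n)%N ->
    (0 < P n [set w | (gamma - eps < X n w < gamma + eps)%R])%E].

Let psi_ge0 : forall x, (0 <= psi x)%E := hLDP.1.

Lemma fin_num_P n (B : set (Omega n)) : measurable B -> P n B \is a fin_num.
Proof. by move=> mB; rewrite fin_num_measure. Qed.

Lemma measurable_X_preimage n (A : set R) : measurable A -> measurable [set w | A (X n w)].
Proof. by move=> mA; rewrite -[X in measurable X]setTI; exact: mX. Qed.

(** If [psi g] were finite, the lower bound on each interval around [g] would give a probability at
    least [expR (- (n * s))] for all large [n], which is attainability. *)
Lemma psi_notin_attainable g : 0 <= g -> ~ Rt g -> psi g = +oo%E.
Proof.
move=> g0 nRt; apply/eqP; rewrite -leye_eq leNgt; apply/negP.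
move=> /lte_real_between[s gs _]; apply: nRt; split => // eps eps0.
pose G : set R := `]g - eps, g + eps[%classic.
have oG : open G by exact: interval_open.
have Gg : G g by rewrite /G/= in_itv/= ltrBlDr ltrDl eps0.
have [N _ NV] := LDP_lower_elim (fun n => P n [set w | G (X n w)]) (psi @` G) (psi g) s
  (fun n => fin_num_P n _ (measurable_X_preimage n G (open_measurable oG)))
  (fun n => measure_ge0 _ _) (hLDP.2.2.2 G oG)
  (ex_intro2 _ _ g Gg erefl) gs.
exists N => n Nn; apply: (@lt_le_trans _ _ (expR (- (n%:R * s)))%:E).
  by rewrite lte_fin expR_gt0.
apply: le_trans (NV n Nn) _; rewrite le_eqVlt; apply/orP; left; apply/eqP.
by congr (P n _); apply/seteqP; split => w; rewrite /G /= in_itv.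
Qed.

Let I (a : R) : \bar R := ereal_inf [set (ell g a + psi g)%E | g in Rt].

Lemma I_lt_ell c g a : (c%:E < I a)%E -> 0 <= g -> (c%:E < ell g a + psi g)%E.
Proof.
move=> cI g0; have [Sg|Sg] := pselect (Rt g).
  by apply: lt_le_trans cI _; apply: ereal_inf_lbound; exists g.
rewrite psi_notin_attainable// addey ?ltry// gt_eqF//.
by rewrite (lt_le_trans _ (ell_ge0 _ _ g0))// ltNyr.
Qed.

Lemma prob_M_pred n (S : pred nat) : (P n [set w | S (M n w)] =
  \int[P n]_w (\sum_(j <oo | S j) (Defs.poisson_pmf (n%:R * X n w) j)%:E))%E.
Proof.
have mMj j : measurable [set w | M n w = j] by exact: (measurable_nat_preimage (M n) [set j]).
rewrite (_ : [set w | _] = \bigcup_(j in [set j | S j]) [set w | M n w = j]); last first.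
  by apply/seteqP; split => [w /= Sw|w [j /= Sj ->]//]; exists (M n w).
rewrite measure_bigcup//; last first.
  by move=> i j _ _ [w [/= <- <-]].
have mpmf j : measurable_fun setT (fun w => (Defs.poisson_pmf (n%:R * X n w) j)%:E).
  apply/measurable_EFinP.
  apply: (@measurableT_comp _ _ _ _ _ _ (fun r => Defs.poisson_pmf r j)).
    exact: measurable_poisson_pmf.
  exact: measurable_funM.
have pmf0 w j : (0 <= (Defs.poisson_pmf (n%:R * X n w) j)%:E)%E.
  by rewrite lee_fin poisson_pmf_ge0// mulr_ge0.
rewrite eseries_mkcond.
transitivity (\sum_(j <oo) \int[P n]_w
    (if S j then (Defs.poisson_pmf (n%:R * X n w) j)%:E else 0))%E.
  apply: eq_eseriesr => j _.
  rewrite (_ : (j \in [set j | S j]) = S j); last by apply/idP/idP => [/set_mem|/mem_set].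
  by case: (S j); [exact: mixed|rewrite integral0].
rewrite -integral_nneseries//.
- by apply: eq_integral => w _; rewrite [RHS]eseries_mkcond.
- by move=> j; case: (S j) => //; exact: measurable_cst.
- by move=> j w _; case: ifP.
Qed.

Lemma measurable_M_preimage n (A : set R) : measurable [set w | A ((M n w)%:R / n%:R)].
Proof. exact: (measurable_nat_preimage (M n) [set j | A (j%:R / n%:R)]). Qed.

Section upper_bound.
Variables (F : set R) (s delta : R) (K : nat).
Hypotheses (cF : closed F) (delta0 : 0 < delta) (Kdelta : s + 2 * delta <= K%:R * delta).
Hypothesis sF : forall g a, F a -> 0 <= g -> ((s + 4 * delta)%:E < ell g a + psi g)%E.

(** Slices of the cost of reaching [F], by steps of [delta]. Beyond level [K] the Chernoff bound
    alone is small enough, by [Kdelta]. *)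
Let C (i : nat) : set R :=
  [set g | 0 <= g /\ exists2 a, F a & (ell g a <= (i%:R * delta)%:E)%E].

Let mC i : measurable (C i).
Proof. by apply: closed_measurable; exact: closed_ell_sublevel. Qed.

(** With [i] minimal such that [x] lies in [C i], every point of [F] costs more than
    [(i - 1) * delta]; for [i = 0] nonnegativity of [ell] suffices. Summing over all [i], rather
    than selecting the minimal one, makes the bound linear in indicators and ready for
    integration. *)
Lemma conditional_upper_bound n (x : R) : (0 < n)%N -> 0 <= x ->
  (\sum_(j <oo | `[< F (j%:R / n%:R)%R >]) (Defs.poisson_pmf (n%:R * x) j)%:E <=
  (\sum_(i < K.+1) (2 * expR (- (n%:R * (i%:R * delta - delta))) * \1_(C i) x) +
   2 * expR (- (n%:R * (K%:R * delta))))%:E)%E.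
Proof.
move=> n0 x0; have np : 0 < n%:R :> R by rewrite ltr0n.
have nx0 : 0 <= n%:R * x by rewrite mulr_ge0.
have term0 (i : 'I_K.+1) : 0 <= 2 * expR (- (n%:R * (i%:R * delta - delta))) * \1_(C i) x.
  by rewrite !mulr_ge0// expR_ge0.
have ellE (j : nat) : ell (n%:R * x) j%:R = (n%:R%:E * ell x (j%:R / n%:R))%E.
  by rewrite -ell_scale// (mulrC n%:R (j%:R / n%:R)) divfK// gt_eqF.
have notinC i (j : nat) : ~ C i x -> F (j%:R / n%:R)%R ->
    ((n%:R * (i%:R * delta))%:E <= ell (n%:R * x) j%:R)%E.
  move=> nC Fj; rewrite ellE EFinM lee_pmul2l//.
  by rewrite leNgt; apply/negP => lt; apply: nC; split => //; exists (j%:R / n%:R) => //; exact: ltW.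
have [CK|nCK] := pselect (C K x); last first.
  apply: le_trans (poisson_chernoff _ (n%:R * (K%:R * delta)) _ nx0 _) _.
    by move=> j /asboolP; exact: notinC.
  by rewrite lee_fin lerDr sumr_ge0.
have ex : exists i, `[< C i x >] by exists K; apply/asboolP.
case: (ex_minnP ex) => i /asboolP Ci imin.
have iK : (i < K.+1)%N by rewrite ltnS imin//; apply/asboolP.
apply: (@le_trans _ _ (2 * expR (- (n%:R * (i%:R * delta - delta))))%:E).
  apply: poisson_chernoff => // j /asboolP Fj.
  case: i {Ci iK} imin => [|i] imin.
    apply: le_trans (ell_ge0 _ _ nx0); rewrite lee_fin mul0r sub0r mulrN oppr_le0.
    by rewrite mulr_ge0// ltW.
  rewrite (_ : i.+1%:R * delta - delta = i%:R * delta); last by rewrite -natr1; ring.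
  by apply: notinC => // Ci; have := imin i; rewrite ltnn => /(_ (asboolT Ci)).
rewrite lee_fin (bigD1 (Ordinal iK))//= indicE mem_set// mulr1 -addrA lerDl.
by rewrite addr_ge0 ?sumr_ge0// mulr_ge0// expR_ge0.
Qed.

Lemma unconditional_upper_bound n : (0 < n)%N ->
  (P n [set w | F ((M n w)%:R / n%:R)%R] <=
  \sum_(i < K.+1) ((2 * expR (- (n%:R * (i%:R * delta - delta))))%:E *
     P n [set w | C i (X n w)]) + (2 * expR (- (n%:R * (K%:R * delta))))%:E)%E.
Proof.
move=> n0.
have mCX i : measurable [set w | C i (X n w)] by exact: measurable_X_preimage.
rewrite (_ : [set w | F _] = [set w | `[< F ((M n w)%:R / n%:R)%R >]]); last first.
  by apply/seteqP; split => w /= /asboolP.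
rewrite (prob_M_pred n (fun j => `[< F (j%:R / n%:R)%R >])).
have mpmf : measurable_fun setT (fun w => \sum_(j <oo | `[< F (j%:R / n%:R)%R >])
    (Defs.poisson_pmf (n%:R * X n w) j)%:E)%E.
  apply: ge0_emeasurable_sum => [j w _ _|j _].
    by rewrite lee_fin poisson_pmf_ge0// mulr_ge0.
  apply/measurable_EFinP.
  apply: (@measurableT_comp _ _ _ _ _ _ (fun r => Defs.poisson_pmf r j)).
    exact: measurable_poisson_pmf.
  exact: measurable_funM.
pose H w : \bar R := (\sum_(i < K.+1) ((2 * expR (- (n%:R * (i%:R * delta - delta))))%:E *
  (\1_[set w | C i (X n w)] w)%:E) + (2 * expR (- (n%:R * (K%:R * delta))))%:E)%E.
have mterm (i : nat) : measurable_fun setT (fun w =>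
    (2 * expR (- (n%:R * (i%:R * delta - delta))))%:E *
    (\1_[set w | C i (X n w)] w : R)%:E)%E.
  by apply: measurable_funeM; apply/measurable_EFinP.
have c0 (r : R) : (0 <= (2 * expR r)%:E)%E by rewrite lee_fin mulr_ge0// expR_ge0.
apply: (@le_trans _ _ (\int[P n]_w H w)%E).
  apply: ge0_le_integral => //.
  - by move=> w _; apply: nneseries_ge0 => j _ _; rewrite lee_fin poisson_pmf_ge0// mulr_ge0.
  - apply: emeasurable_funD => //; apply: emeasurable_sum => i _; exact: mterm.
  - move=> w _; apply: le_trans (conditional_upper_bound n _ n0 (X0 n w)) _.
    by rewrite EFinD -sumEFin.
rewrite ge0_integralD//; last 2 first.
- by move=> w _; apply: sume_ge0 => i _; rewrite mule_ge0.
- by apply: emeasurable_sum => i _; exact: mterm.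
rewrite integral_cst//= probability_setT mule1 leeD2r//.
rewrite ge0_integral_sum//.
apply: lee_sum => i _; rewrite ge0_integralZl//; last exact/measurable_EFinP.
by rewrite integral_indic// setIT.
Qed.

(** On [C i] some point of [F] costs at most [i * delta], so [psi] pays at least
    [s + 4 * delta - i * delta]. One [delta] is lost to strictness and one to the width of a slice;
    every product then has rate [s + 2 * delta], and the remaining [2 * delta] absorbs the number of
    terms. *)
Lemma upper_bound_near : \forall n \near \oo,
  (P n [set w | F ((M n w)%:R / n%:R)%R] <= (expR (- (n%:R * s)))%:E)%E.
Proof.
have PC (i : nat) : \forall n \near \oo, (P n [set w | C i (X n w)] <=
    (expR (- (n%:R * (s + 3 * delta - i%:R * delta))))%:E)%E.
  apply: (LDP_upper_elim (fun n => P n [set w | C i (X n w)]) (psi @` C i)).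
  - by move=> n; apply: fin_num_P; exact: measurable_X_preimage.
  - by move=> n; exact: measure_ge0.
  - by apply: (hLDP.2.2.1 (C i)); exact: closed_ell_sublevel.
  - apply: (@lt_le_trans _ _ (s + 4 * delta - i%:R * delta)%:E).
      by rewrite lte_fin ltrD2r ltrD2l ltr_pM2r// ltr_nat.
    apply: le_ereal_inf_tmp => _ [g [g0 [a Fa ga]] <-].
    rewrite EFinB leeBlDl//; apply: ltW; apply: lt_le_trans (sF g a Fa g0) _.
    exact: leeD2r.
have PCall : \forall n \near \oo, forall i : 'I_K.+1, (P n [set w | C i (X n w)] <=
    (expR (- (n%:R * (s + 3 * delta - i%:R * delta))))%:E)%E.
  by apply: filter_forall => i; exact: PC.
near=> n.
have n0 : (0 < n)%N by near: n; exact: nbhs_infty_gt.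
have PCn : forall i : 'I_K.+1, (P n [set w | C i (X n w)] <=
    (expR (- (n%:R * (s + 3 * delta - i%:R * delta))))%:E)%E by near: n.
apply: le_trans (unconditional_upper_bound n n0) _.
pose e := expR (- (n%:R * (s + 2 * delta))).
apply: (@le_trans _ _ (\sum_(i < K.+1) (2 * e)%:E + (2 * e)%:E)%E).
  apply: leeD.
    apply: lee_sum => i _.
    apply: (@le_trans _ _ ((2 * expR (- (n%:R * (i%:R * delta - delta))))%:E *
       (expR (- (n%:R * (s + 3 * delta - i%:R * delta))))%:E)%E).
      by apply: lee_wpmul2l => //; rewrite lee_fin mulr_ge0// expR_ge0.
    rewrite -EFinM lee_fin -mulrA -expRD ler_wpM2l// /e ler_expR.
    by rewrite le_eqVlt; apply/orP; left; apply/eqP; ring.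
  by rewrite lee_fin ler_wpM2l// /e ler_expR lerN2 ler_wpM2l.
rewrite sumEFin sumr_const card_ord -EFinD lee_fin.
rewrite (_ : - (n%:R * s) = - (n%:R * (s + 2 * delta)) + n%:R * (2 * delta)); last by ring.
rewrite expRD -/e (_ : 2 * e *+ K.+1 + 2 * e = e * (2 * K.+2%:R)); last first.
  by rewrite -[X in X + _]mulr_natr -[K.+2%:R]natr1; ring.
rewrite ler_wpM2l ?expR_ge0//; apply: le_trans (expR_ge1Dx _).
rewrite -lerBlDl; apply: (@le_trans _ _ (2 * K.+2%:R)); first by rewrite gerBl.
rewrite -ler_pdivrMr ?mulr_gt0//.
by near: n; exact: nbhs_infty_ger.
Unshelve. all: by end_near. Qed.
End upper_bound.

(** A single atom suffices: the count equals the integer part of [n * a], with the parameter near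
    [g]. Half of the slack, [eta], goes to the Poisson weight and half to the law of the
    parameter. *)
Lemma lower_bound_near (G : set R) (a s : R) : open G -> G a -> (I a < s%:E)%E ->
  \forall n \near \oo,
    ((expR (- (n%:R * s)))%:E <= P n [set w | G ((M n w)%:R / n%:R)%R])%E.
Proof.
move=> oG Ga /ereal_inf_lt [_ [g [g0 _] <-] gs].
have e0 := ell_ge0 g a g0; have p0 := psi_ge0 g.
case eE : (ell g a) gs e0 => [e| |]//; case pE : (psi g) p0 => [p| |]//.
rewrite -EFinD lte_fin !lee_fin => p0 eps e0.
pose eta := (s - e - p) / 2.
have eta0 : 0 < eta by rewrite /eta; lra.
have a0 : 0 <= a by move: eE; rewrite /ell; case: (ltP a 0).
have [eps' eps'0 Hpmf] := poisson_pmf_lower_bound g a e eta g0 eE eta0.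
pose B : set R := `]g - eps', g + eps'[%classic.
have oB : open B by exact: interval_open.
have mB n : measurable [set w | B (X n w)].
  by apply: measurable_X_preimage; exact: open_measurable.
have Bg : B g by rewrite /B/= in_itv/= ltrBlDr ltrDl eps'0.
have PB : \forall n \near \oo,
    ((expR (- (n%:R * (p + eta))))%:E <= P n [set w | B (X n w)])%E.
  apply: (LDP_lower_elim (fun n => P n [set w | B (X n w)]) (psi @` B) (psi g)) => //.
  - by move=> n; exact: fin_num_P.
  - exact: (hLDP.2.2.2 B oB).
  - by rewrite pE lte_fin ltrDl.
have Gn : \forall n \near \oo, G ((Num.truncn (n%:R * a))%:R / n%:R).
  have := cvg_truncn_ratio a a0; apply.
  by apply: open_nbhs_nbhs; split.
near=> n.
set j := Num.truncn (n%:R * a).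
have Gj : G (j%:R / n%:R) by rewrite /j; near: n; exact: Gn.
have pmfn : forall x, 0 <= x -> g - eps' < x < g + eps' ->
    expR (- (n%:R * (e + eta))) <= Defs.poisson_pmf (n%:R * x) j by rewrite /j; near: n; exact: Hpmf.
have PBn : ((expR (- (n%:R * (p + eta))))%:E <= P n [set w | B (X n w)])%E.
  by near: n; exact: PB.
have mMj : measurable [set w | M n w = j] by exact: (measurable_nat_preimage (M n) [set j]).
apply: (@le_trans _ _ (P n [set w | M n w = j])); last first.
  apply: le_measure; rewrite ?inE//; first exact: measurable_M_preimage.
  by move=> w /= ->.
rewrite mixed.
apply: (@le_trans _ _ ((expR (- (n%:R * (e + eta))))%:E * P n [set w | B (X n w)])%E).
  apply: (@le_trans _ _ ((expR (- (n%:R * (e + eta))))%:E * (expR (- (n%:R * (p + eta))))%:E)%E).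
    rewrite -EFinM lee_fin -expRD ler_expR le_eqVlt; apply/orP; left; apply/eqP.
    by rewrite /eta; field.
  by apply: lee_wpmul2l => //; rewrite lee_fin expR_ge0.
have mpmf : measurable_fun setT (fun w => (Defs.poisson_pmf (n%:R * X n w) j)%:E).
  apply/measurable_EFinP.
  apply: (@measurableT_comp _ _ _ _ _ _ (fun r => Defs.poisson_pmf r j)).
    exact: measurable_poisson_pmf.
  exact: measurable_funM.
have mI : measurable_fun setT (fun w => (\1_[set w | B (X n w)] w : R)%:E).
  by apply/measurable_EFinP; exact: measurable_indic.
rewrite -[X in (_ * P n X)%E]setIT -integral_indic// -ge0_integralZl//.
apply: ge0_le_integral => //.
- exact: measurable_funeM.
- move=> w _; rewrite -EFinM lee_fin indicE.
  case: (boolP (w \in _)) => [|_]; last by rewrite mulr0 poisson_pmf_ge0// mulr_ge0.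
  by rewrite inE/= /B/= in_itv/= mulr1 => Bw; exact: pmfn.
Unshelve. all: by end_near. Qed.

Lemma LDP_mixed_poisson : LDP (fun n (A : set R) => P n [set w | A ((M n w)%:R / n%:R)]) I.
Proof.
split.
  move=> a; apply: le_ereal_inf_tmp => _ [g [g0 _] <-].
  by rewrite adde_ge0// ell_ge0.
split.
  apply: lower_semicontinuous_inf_ell => //; first exact: hLDP.2.1.
    by move=> g [].
  exact: psi_notin_attainable.
have finM (A : set R) n : P n [set w | A ((M n w)%:R / n%:R)%R] \is a fin_num.
  exact: (fin_num_P n _ (measurable_M_preimage n A)).
split => [F cF|G oG].
  apply: LDP_upper_intro => // s /lte_real_between[s']; rewrite lte_fin => ss' s'F.
  (* A quarter of the gap, so that [s + 4 * delta] is [s']; [K] rounds up the cutoff that [Kdelta]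
     requires. *)
  pose delta := (s' - s) / 4.
  have delta0 : 0 < delta by rewrite /delta; lra.
  pose K := (Num.truncn ((s + 2 * delta) / delta)).+1.
  apply: (upper_bound_near F s delta K cF delta0).
    by rewrite -ler_pdivrMr//; apply/ltW; exact: truncnS_gt.
  move=> g a Fa g0; apply: I_lt_ell => //.
  rewrite (_ : s + 4 * delta = s'); last by rewrite /delta; field.
  by apply: lt_le_trans s'F _; apply: ereal_inf_lbound; exists a.
apply: LDP_lower_intro => // _ s [a Ga <-]; exact: lower_bound_near.
Qed.

End mixed_poisson_LDP.

(** * Independence of background, arrivals and marks *)

Section independence_of_model.
Context {d : measure_display} {Omega : measurableType d} {R : realType}
  {E : topologicalType}.
Variables (P : probability Omega R) (J : Omega -> R -> E) (Y : Omega -> R -> nat)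
  (Z : Omega -> nat -> R).
Hypotheses (J_meas : forall s (B : set E), 0 <= s -> open B ->
    measurable ((fun w => J w s) @^-1` B))
  (Y_poisson : std_poisson_process P Y)
  (Z_exp : forall k, std_exponential P (fun w => Z w k)).
Hypothesis indep : mutually_independent P
  (fun i : nat => match i with
                  | 0%N => sigma_process J
                  | 1%N => sigma_nat_process Y
                  | k.+2 => sigma_rv (fun w => Z w k)
                  end).

Definition background_gen : set (set Omega) :=
  [set A | exists s B, 0 <= s /\ open B /\ A = (fun w => J w s) @^-1` B].
Definition arrival_gen : set (set Omega) :=
  [set A | exists s k, 0 <= s /\ A = [set w | Y w s = k]].
(** Finite cylinder events of the marks, written as intersections over all [k] with factors
    eventually [setT], so that two of them intersect factor by factor. The class generates the
    sigma-algebra of the whole sequence of marks and is stable under intersection. *)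
Definition marks_gen : set (set Omega) :=
  [set A | exists C : nat -> set Omega, exists K : nat,
    [/\ forall k, sigma_rv (fun w => Z w k) (C k),
        forall k, (K <= k)%N -> C k = setT & A = \bigcap_k C k]].

Local Notation TJ := (g_sigma_algebraType background_gen).
Local Notation TY := (g_sigma_algebraType arrival_gen).
Local Notation TZ := (g_sigma_algebraType marks_gen).

Lemma background_gen_measurable : background_gen `<=` measurable.
Proof. by move=> _ [s [B [s0 [oB ->]]]]; exact: J_meas. Qed.

Lemma arrival_gen_measurable : arrival_gen `<=` measurable.
Proof. by move=> _ [s [k [s0 ->]]]; have [_ [_ [_ [+ _]]]] := Y_poisson; apply. Qed.

Lemma sigma_rv_setT k : sigma_rv (fun w => Z w k) setT.
Proof. by apply: sub_sigma_algebra; exists setT. Qed.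

Lemma sigma_rv_measurable k : sigma_rv (fun w => Z w k) `<=` measurable.
Proof.
apply: (smallest_sub (@sigma_algebra_measurable _ Omega)) => _ [B [mB ->]].
by rewrite -[X in measurable X]setTI; exact: (Z_exp k).1.
Qed.

Lemma marks_gen_measurable : marks_gen `<=` measurable.
Proof.
move=> _ [C [K [sC _ ->]]]; apply: bigcapT_measurable => k.
exact: (sigma_rv_measurable k _ (sC k)).
Qed.

Lemma marks_gen_setI : setI_closed marks_gen.
Proof.
move=> _ _ [C [K [sC CT ->]]] [C' [K' [sC' CT' ->]]].
exists (fun k => C k `&` C' k), (maxn K K'); split.
- move=> k; have sig := @smallest_sigma_algebra _ setT
    [set A | exists B, measurable B /\ A = (fun w => Z w k) @^-1` B].
  exact: (@measurableI _ (g_sigma_algebraType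
    [set A | exists B, measurable B /\ A = (fun w => Z w k) @^-1` B]) _ _ (sC k) (sC' k)).
- by move=> k; rewrite geq_max => /andP[/CT -> /CT' ->]; rewrite setTI.
- by rewrite bigcapI.
Qed.

Lemma marks_gen_setT : marks_gen setT.
Proof.
exists (fun=> setT), 0%N; split => //; first by move=> k; exact: sigma_rv_setT.
by apply/seteqP; split.
Qed.

Lemma marks_measurable k : measurable_fun setT ((fun w => Z w k) : TZ -> R).
Proof.
move=> _ B mB; rewrite setTI; apply: sub_sigma_algebra.
exists (fun i => if i == k then (fun w => Z w k) @^-1` B else setT), k.+1; split.
- move=> i; case: eqVneq => [->|_]; last exact: sigma_rv_setT.
  by apply: sub_sigma_algebra; exists B.
- by move=> i ki; case: eqVneq => // ik; rewrite ik ltnn in ki.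
- apply/seteqP; split => [w Bw i _|w /(_ k I)]; last by rewrite eqxx.
  by case: eqVneq.
Qed.

(** The marks sit at the indices from [2] on. Mutual independence is used twice: on all indices, and
    on the marks alone to recognise their product as [P C]. *)
Lemma background_arrivals_marks_independent (A B C : set Omega) :
  sigma_process J A -> sigma_nat_process Y B -> marks_gen C ->
  P (A `&` (B `&` C)) = (P A * (P B * P C))%E.
Proof.
move=> sA sB [D [K [sD DT ->]]].
pose F i := match i with 0%N => A | 1%N => B | k.+2 => D k end.
have DE : \bigcap_k D k = \big[setI/setT]_(k <- iota 0 K) D k.
  rewrite (_ : iota 0 K = index_iota 0 K); last by rewrite /index_iota subn0.
  rewrite big_mkord -bigcap_mkord; apply/seteqP; split => w Dw k; first by move=> _; exact: Dw.
  move=> _; have [kK|Kk] := ltnP k K; first exact: Dw.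
  by rewrite DT.
have FE : \big[setI/setT]_(i <- iota 2 K) F i = \bigcap_k D k.
  by rewrite DE (iotaDl 2 0) big_map; apply: eq_bigr.
have sF i : match i with
    | 0%N => sigma_process J
    | 1%N => sigma_nat_process Y
    | k.+2 => sigma_rv (fun w => Z w k)
    end (F i) by case: i => [|[|k]] //=.
have PD := indep (iota 2 K) F (iota_uniq _ _) (fun i _ => sF i).
have := indep (iota 0 K.+2) F (iota_uniq _ _) (fun i _ => sF i).
by rewrite /= !big_cons -PD FE.
Qed.

Lemma arrivals_independent_of_background :
  independent_rv P ((fun w => w) : Omega -> TJ) ((fun w => w) : Omega -> TY).
Proof.
move=> A B mA mB.
have := background_arrivals_marks_independent A B setT mA mB marks_gen_setT.
by rewrite setIT probability_setT mule1.
Qed.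

Lemma marks_independent_of_rest :
  independent_rv P (fun w => ((w : TJ), (w : TY))) ((fun w => w) : Omega -> TZ).
Proof.
apply: (independent_rv_pair P _ _ _ TJ TY TZ (fun w => w) (fun w => w) (fun w => w) marks_gen).
- exact: measurable_id_g_sigma_algebra background_gen_measurable.
- exact: measurable_id_g_sigma_algebra arrival_gen_measurable.
- exact: measurable_id_g_sigma_algebra marks_gen_measurable.
- exact: marks_gen_setI.
- exact: marks_gen_setT.
- by [].
- exact: background_arrivals_marks_independent.
Qed.

Lemma marks_mutually_independent (K : nat) (C : nat -> set R) :
  (forall k, measurable (C k)) ->
  P (\big[setI/setT]_(k < K) ((fun w => Z w k) @^-1` C k)) =
  (\prod_(k < K) P ((fun w => Z w k) @^-1` C k))%E.
Proof.
move=> mC; pose F i := match i with k.+2 => (fun w => Z w k) @^-1` C k | _ => setT end.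
have := indep (iota 2 K) F (iota_uniq _ _).
rewrite (iotaDl 2 0) !big_map (_ : iota 0 K = index_iota 0 K); last first.
  by rewrite /index_iota subn0.
rewrite !big_mkord; apply => i /mapP[k _ ->] /=.
by apply: sub_sigma_algebra; exists (C k).
Qed.

End independence_of_model.

(** * The queue *)

Section queue_count_law.
Context {d : measure_display} {Omega : measurableType d} {R : realType}
  {E : topologicalType}.
Variables (P : probability Omega R) (J : Omega -> R -> E) (Y : Omega -> R -> nat)
  (Z : Omega -> nat -> R) (lam kap mu : E -> R) (t : R).
Hypotheses (lam_cont : continuous lam) (kap_cont : continuous kap)
  (mu_cont : continuous mu).
Hypotheses (lam_ge0 : forall x, 0 <= lam x) (kap_ge0 : forall x, 0 <= kap x)
  (mu_ge0 : forall x, 0 <= mu x) (t0 : 0 <= t).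
Hypotheses (J_cadlag : forall w, cadlag (J w))
  (J_meas : forall s (B : set E), 0 <= s -> open B ->
    measurable ((fun w => J w s) @^-1` B))
  (Y_poisson : std_poisson_process P Y)
  (Z_exp : forall k, std_exponential P (fun w => Z w k)).
Hypothesis indep : mutually_independent P
  (fun i : nat => match i with
                  | 0%N => sigma_process J
                  | 1%N => sigma_nat_process Y
                  | k.+2 => sigma_rv (fun w => Z w k)
                  end).

(** Copies of [Omega] with smaller sigma-algebras. The identity maps into them act as random
    background, arrivals and marks, whose sample points can then vary separately. *)
Let TJ : measurableType _ := g_sigma_algebraType (background_gen J).
Let TY : measurableType _ := g_sigma_algebraType (arrival_gen Y).
Let TZ : measurableType _ := g_sigma_algebraType (marks_gen Z).

Let mJ : measurable_fun setT ((fun w => w) : Omega -> TJ).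
Proof. exact: measurable_id_g_sigma_algebra (background_gen_measurable J J_meas). Qed.

Let mY : measurable_fun setT ((fun w => w) : Omega -> TY).
Proof. exact: measurable_id_g_sigma_algebra (arrival_gen_measurable P Y Y_poisson). Qed.

Let mZ : measurable_fun setT ((fun w => w) : Omega -> TZ).
Proof. exact: measurable_id_g_sigma_algebra (marks_gen_measurable P Z Z_exp). Qed.

Let TJ_meas s (B : set E) : 0 <= s -> open B ->
  @measurable _ TJ ((fun w : TJ => J w s) @^-1` B).
Proof. by move=> s0 oB; apply: sub_sigma_algebra; exists s, B. Qed.

Let TY_meas s k : 0 <= s -> @measurable _ TY [set w : TY | Y w s = k].
Proof. by move=> s0; apply: sub_sigma_algebra; exists s, k. Qed.

Lemma measurable_queue_count :
  measurable_fun setT (fun w => queue_count lam kap mu (J w) (Y w) (Z w) t).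
Proof.
have [Y0 [Ymono [Yrc _]]] := Y_poisson.
exact: (@measurable_M R E lam kap mu lam_cont kap_cont mu_cont lam_ge0 kap_ge0 mu_ge0
  t t0 _ _ _ TJ TY TZ J Y Z J_cadlag TJ_meas Y0 Ymono Yrc TY_meas (marks_measurable Z)
  _ Omega (fun w => w) (fun w => w) (fun w => w) mJ mY mZ).
Qed.

Lemma queue_count_mixed_poisson :
  measurable_fun setT (fun w => phi lam kap mu t (J w)) ->
  forall j, (P [set w | queue_count lam kap mu (J w) (Y w) (Z w) t = j] =
    \int[P]_w (Defs.poisson_pmf (phi lam kap mu t (J w)) j)%:E)%E.
Proof.
move=> mphi; have [Y0 [Ymono [Yrc _]]] := Y_poisson.
apply: mixed_poisson_of_pgf => //.
- exact: measurable_queue_count.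
- by move=> w; exact: phi_ge0.
- exact: (@M_generating_function R E lam kap mu lam_cont kap_cont mu_cont lam_ge0 kap_ge0
  mu_ge0 t t0 _ _ _ TJ TY TZ J Y Z J_cadlag TJ_meas Y0 Ymono Yrc TY_meas (marks_measurable Z)
  _ Omega P (fun w => w) (fun w => w) (fun w => w) mJ mY mZ
  (arrivals_independent_of_background P J Y Z indep)
  (marks_independent_of_rest P J Y Z J_meas Y_poisson Z_exp indep)
  Y_poisson Z_exp (marks_mutually_independent P J Y Z indep)).
Qed.

End queue_count_law.

Theorem theorem1
  (R : realType) (E : metricType R)
  (lam kap mu : E -> R)
  (lam_cont : continuous lam) (kap_cont : continuous kap) (mu_cont : continuous mu)
  (lam_ge0 : forall x, 0 <= lam x) (kap_ge0 : forall x, 0 <= kap x)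
  (mu_ge0 : forall x, 0 <= mu x)
  (t : R) (t_ge0 : 0 <= t)
  (* the n-th queue lives on its own probability space (Omega n, P n) *)
  (d : nat -> measure_display) (Omega : forall n, measurableType (d n))
  (P : forall n, probability (Omega n) R)
  (* background process J_n, standard Poisson process Ybar_n, marks Zbar_n *)
  (J : forall n, Omega n -> R -> E)
  (Ybar : forall n, Omega n -> R -> nat)
  (Z : forall n, Omega n -> nat -> R)
  (J_cadlag : forall n w, cadlag (J n w))
  (J_meas : forall n s (B : set E), 0 <= s -> open B ->
             measurable ((fun w => J n w s) @^-1` B))
  (Ybar_poisson : forall n, std_poisson_process (P n) (Ybar n))
  (Z_exp : forall n k, std_exponential (P n) (fun w => Z n w k))
  (indep : forall n, mutually_independent (P n)
     (fun i : nat => match i with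
                     | 0%N => sigma_process (J n)
                     | 1%N => sigma_nat_process (Ybar n)
                     | k.+2 => sigma_rv (fun w => Z n w k)
                     end))
  (* phi_t(J_n) is a random variable (presupposed by "the law of phi_t(J_n)") *)
  (phi_meas : forall n, measurable_fun setT (fun w => phi lam kap mu t (J n w)))
  (psi : R -> \bar R)
  (hLDP : LDP (fun n (A : set R) =>
                 P n [set w | A (phi lam kap mu t (J n w))]) psi) :
  let Rt : set R :=
    [set gamma : R | 0 <= gamma /\
       forall eps : R, 0 < eps -> exists N : nat, forall n : nat, (N <= n)%N ->
         (0 < P n [set w | (gamma - eps < phi lam kap mu t (J n w) < gamma + eps)%R])%E] in
  let I : R -> \bar R :=
    fun a => ereal_inf [set (ell (gamma : R) a + psi gamma)%E | gamma in Rt] in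
  let M : forall n, Omega n -> nat :=
    fun n w => queue_count (fun x => n%:R * lam x) kap mu (J n w) (Ybar n w) (Z n w) t in
  LDP (fun n (A : set R) => P n [set w | A ((M n w)%:R / n%:R)]) I.
Proof.
move=> Rt I M.
have scale_cont n : continuous (fun x => n%:R * lam x).
  by move=> x; apply: cvgMr; exact: lam_cont.
have scale_ge0 n x : 0 <= n%:R * lam x by rewrite mulr_ge0.
(* Scaling the arrival rate scales [phi], so the mean of the [n]-th count is [n] times the variable
   whose principle is assumed. *)
have phiE n w : phi (fun x => n%:R * lam x) kap mu t (J n w) =
    n%:R * phi lam kap mu t (J n w) by exact: phi_scale.
have mphi n : measurable_fun setT
    (fun w => phi (fun x => n%:R * lam x) kap mu t (J n w)).
  by under eq_fun do rewrite phiE; exact: measurable_funM.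
apply: (@LDP_mixed_poisson R d Omega P (fun n w => phi lam kap mu t (J n w)) M) => //.
- move=> n; apply: (measurable_queue_count (P n) (J n) (Ybar n) (Z n)
    (fun x => n%:R * lam x) kap mu t) => //; exact: J_meas.
- by move=> n w; exact: phi_ge0.
- move=> n j; under eq_integral do rewrite -phiE.
  apply: (queue_count_mixed_poisson (P n) (J n) (Ybar n) (Z n)
    (fun x => n%:R * lam x) kap mu t) => //; exact: J_meas.
Qed.
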